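(* Consider the DC network $$-L_s\dot I_s=R_sI_s+V-u,\qquad -L_t\dot I_t=R_tI_t+\mathcal B^\top V,\qquad C_s\dot V=I_s+\mathcal B I_t-I_l(V),$$ with ZIP-loads $I_l(V)=Z_l^{*-1}V+I_l^*+[V]^{-1}P_l^*$, state $(I_s,I_t,V)\in\mathcal X$ and input $u$, where all data are as described in the context. Let $\Pi=\operatorname{diag}\{\pi_1,\dots,\pi_n\}$ with $\pi_i\ge0$ and $P_{li}^*\le\pi_i$ for all $i=1,\dots,n$. Let $K_1,K_2\in\mathbb R^{n\times n}$ be symmetric with $K_1\ge0$ (positive semidefinite) and $K_2>0$ (positive definite), let $V^*\in\mathbb R^n_{>0}$, and define $$u_{\mathrm{PBC}}:=R_sI_s-L_s\Pi[V]^{-2}\dot V,\qquad u_{\mathrm{Stab}}:=-L_sK_1(V-V^* )-L_sK_2\dot V+V^*.$$ Then the following statements hold. (i) Let $\mu$ be an $\mathbb R^n$-valued input and consider $$u=L_s\mu+u_{\mathrm{PBC}}+u_{\mathrm{Stab}}.$$ The closed-loop system is passive with respect to the supply rate $\mu^\top\dot V$ and the storage function $S_d=\mathcal P_A+S_a$, where $$\mathcal P_A(I_s,I_t,V)=\tfrac12\|V\|^2_{L_s^{-1}}+\tfrac12\|R_tI_t+\mathcal B^\top V\|^2_{L_t^{-1}}+\tfrac12\|I_s+\mathcal BI_t-I_l(V)\|^2_{C_s^{-1}},$$ $$S_a(V)=\tfrac12\|V-V^*\|^2_{K_1}-V^\top L_s^{-1}V^*+\tfrac12\|V^*\|^2_{L_s^{-1}}.$$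 (ii) Consider the closed-loop system with $\mu=0$. Then the equilibrium $(\overline I_s,\overline I_t,V^* )\in\mathcal X$, where $\overline I_t=-R_t^{-1}\mathcal B^\top V^*$ and $\overline I_s=-\mathcal B\overline I_t+Z_l^{*-1}V^*+I_l^*+[V^*]^{-1}P_l^*$, is asymptotically stable in $\mathcal X$.
   Context: Network data: $n$ is the number of nodes and $m$ the number of edges (lines) of a connected undirected graph; after labelling the ends of each edge arbitrarily by $+$ and $-$, $\mathcal B\in\mathbb R^{n\times m}$ is the incidence matrix ($\mathcal B_{ik}=+1$ if node $i$ is the positive end of edge $k$, $-1$ if it is the negative end, $0$ otherwise). $L_s,C_s,R_s\in\mathbb R^{n\times n}$ and $L_t,R_t\in\mathbb R^{m\times m}$ are positive definite diagonal matrices. The load data are $P_l^*,I_l^*\in\mathbb R^n_{\ge0}$ and a diagonal matrix $Z_l^{*-1}\in\mathbb R^{n\times n}$ with nonnegative diagonal entries. The signals are $I_s(t)\in\mathbb R^n$, $I_t(t)\in\mathbb R^m$, $V(t)\in\mathbb R^n$, $u(t)\in\mathbb R^n$. Notation: for $v\in\mathbb R^n$, $[v]:=\operatorname{diag}\{v_1,\dots,v_n\}$. For a symmetric positive semidefinite matrix $N$, $\|y\|_N:=(y^\top Ny)^{1/2}$. $\mathcal X:=\{(I_s,I_t,V)\in\mathbb R^{2n+m}\mid V_i>0\ \text{for all } i\}$. In the control law, $\dot V$ stands for its value along the network dynamics, $\dot V=C_s^{-1}(I_s+\mathcal BI_t-I_l(V))$, so that the closed loop is an ordinary differential equation on $\mathcal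 X$. Passivity: a system is passive with respect to a storage function $S$ and a supply rate $w$ if $S\ge0$ on $\mathcal X$ and, along every solution of the system evolving in $\mathcal X$ (for every input signal), $\frac{d}{dt}S\le w$. Asymptotically stable in $\mathcal X$: for the closed-loop system regarded as a dynamical system with state space the open set $\mathcal X$, the equilibrium is Lyapunov stable and there is a neighbourhood of it in $\mathcal X$ such that every solution starting in this neighbourhood stays in $\mathcal X$ for all $t\ge0$ and converges to the equilibrium. *)

(* Defs.v *)
From HB Require Import structures.
From mathcomp Require Import all_boot all_order all_algebra.
From mathcomp Require Import all_classical all_reals all_analysis.

Set Implicit Arguments.
Unset Strict Implicit.
Unset Printing Implicit Defensive.

Import Order.TTheory GRing.Theory Num.Theory.
Import numFieldNormedType.Exports.

Local Open Scope classical_set_scope.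
Local Open Scope ring_scope.

Section Matrices.
Variables (R : realType) (n : nat).
Implicit Types (N : 'M[R]_n) (v y : 'cV[R]_n).

Definition quadform N y : R := (y^T *m N *m y) 0 0.

Definition psdmx N : Prop := N^T = N /\ forall y, 0 <= quadform N y.

Definition pdmx N : Prop := N^T = N /\ forall y, y != 0 -> 0 < quadform N y.

Definition diagc v : 'M[R]_n := diag_mx v^T.

Definition wnorm N y : R := Num.sqrt (quadform N y).

End Matrices.

(* Ordinary differential equations  F t (x t) (x' t)  on a state space X.     *)
(* A relation F is used so that equations can be written in the implicit form *)
(* in which they are usually given; an explicit field f is F t x dx := dx = f x. *)
Section Ode.
Variables (R : realType) (E : normedModType R).
Implicit Types (J : set R) (X : set E) (T : \bar R) (x : R -> E).

(* Derivative relative to J: two-sided in the interior of J, one-sided at an  *)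
(* endpoint of J; values of x outside J are irrelevant.                       *)
Definition is_derive_within (E' : normedModType R) J (x : R -> E') (t : R)
    (dx : E') : Prop :=
  (fun h : R => h^-1 *: (x (t + h) - x t))
    @ within [set h | J (t + h)] (0 : R)^' --> dx.

Definition horizon T : set R := [set t | 0 <= t /\ (t%:E < T)%E].

Definition solution X (F : R -> E -> E -> Prop) T x : Prop :=
  (0 < T)%E /\
  forall t, horizon T t ->
    X (x t) /\
    exists2 dx, is_derive_within (horizon T) x t dx & F t (x t) dx.

Definition maximal_solution X (F : R -> E -> E -> Prop) T x : Prop :=
  solution X F T x /\
  forall T' y, solution X F T' y ->
    (forall t, horizon T t -> y t = x t) -> (T' <= T)%E.

Definition passive (U : Type) X (F : U -> E -> E -> Prop)
    (S : E -> R) (w : U -> E -> R) : Prop :=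
  (forall z, X z -> 0 <= S z) /\
  forall T (mu : R -> U) x, solution X (fun t => F (mu t)) T x ->
    forall t, horizon T t ->
      exists2 s : R, is_derive_within (horizon T) (S \o x) t s
                   & s <= w (mu t) (x t).

Definition equilibrium X (F : E -> E -> Prop) (xe : E) : Prop :=
  X xe /\ F xe 0.

Definition lyapunov_stable X (F : E -> E -> Prop) (xe : E) : Prop :=
  forall W : set E, nbhs xe W ->
    \forall x0 \near xe, forall T x,
      solution X (fun=> F) T x -> x 0 = x0 -> forall t, horizon T t -> W (x t).

(* A maximal solution takes its values in X, so having the horizon [0, +oo[   *)
(* means that it neither leaves X nor escapes in finite time.                 *)
Definition locally_attractive X (F : E -> E -> Prop) (xe : E) : Prop :=
  \forall x0 \near xe, forall T x,
    maximal_solution X (fun=> F) T x -> x 0 = x0 ->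
    T = +oo%E /\ x t @[t --> +oo] --> xe.

Definition asymptotically_stable X (F : E -> E -> Prop) (xe : E) : Prop :=
  [/\ equilibrium X F xe, lyapunov_stable X F xe & locally_attractive X F xe].

End Ode.

Section Graph.
Variables (n m : nat).
Implicit Types (pos neg : 'I_m -> 'I_n).

(* Edge k joins pos k and neg k.                                              *)
Definition adjacent pos neg : rel 'I_n := fun i j =>
  [exists k, ((pos k == i) && (neg k == j)) || ((pos k == j) && (neg k == i))].

Definition connected_graph pos neg : Prop :=
  (0 < n)%N /\ forall i j, connect (adjacent pos neg) i j.

Definition incidence (R : realType) pos neg : 'M[R]_(n, m) :=
  \matrix_(i, k) (if i == pos k then 1 else if i == neg k then -1 else 0).

End Graph.

(* ZlV stands for Z_l^{*-1}, which may be singular.                           *)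
Record dc_network (R : realType) (n m : nat) := DcNetwork {
  pos_end : 'I_m -> 'I_n;
  neg_end : 'I_m -> 'I_n;
  Ls : 'M[R]_n; Cs : 'M[R]_n; Rs : 'M[R]_n;
  Lt : 'M[R]_m; Rt : 'M[R]_m;
  Pl : 'cV[R]_n; Il : 'cV[R]_n; ZlV : 'M[R]_n;
  ends_neq : forall k, pos_end k != neg_end k;
  net_connected : connected_graph pos_end neg_end;
  Ls_diag : is_diag_mx Ls; Ls_pd : pdmx Ls;
  Cs_diag : is_diag_mx Cs; Cs_pd : pdmx Cs;
  Rs_diag : is_diag_mx Rs; Rs_pd : pdmx Rs;
  Lt_diag : is_diag_mx Lt; Lt_pd : pdmx Lt;
  Rt_diag : is_diag_mx Rt; Rt_pd : pdmx Rt;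
  Pl_ge0 : forall i, 0 <= Pl i 0;
  Il_ge0 : forall i, 0 <= Il i 0;
  ZlV_diag : is_diag_mx ZlV; ZlV_ge0 : forall i, 0 <= ZlV i i
}.

(* A state is a triple (I_s, I_t, V); velocities have the same type.          *)
Definition state (R : realType) (n m : nat) : normedModType R :=
  ('cV[R]_n * 'cV[R]_m * 'cV[R]_n)%type.

Section Network.
Variables (R : realType) (n m : nat) (N : dc_network R n m).
Implicit Types (x dx : state R n m) (V u mu Vstar pi : 'cV[R]_n).
Implicit Types (K : 'M[R]_n).

Definition sIs x : 'cV[R]_n := x.1.1.
Definition sIt x : 'cV[R]_m := x.1.2.
Definition sV x : 'cV[R]_n := x.2.

Definition statespace : set (state R n m) := [set x | forall i, 0 < sV x i 0].

Definition Binc : 'M[R]_(n, m) := incidence R (pos_end N) (neg_end N).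

Definition load_current V : 'cV[R]_n :=
  ZlV N *m V + Il N + invmx (diagc V) *m Pl N.

Definition network_dynamics u x dx : Prop :=
  [/\ - Ls N *m sIs dx = Rs N *m sIs x + sV x - u,
      - Lt N *m sIt dx = Rt N *m sIt x + Binc^T *m sV x
    & Cs N *m sV dx = sIs x + Binc *m sIt x - load_current (sV x)].

Definition Vdot x : 'cV[R]_n :=
  invmx (Cs N) *m (sIs x + Binc *m sIt x - load_current (sV x)).

Definition u_PBC pi x : 'cV[R]_n :=
  Rs N *m sIs x
  - Ls N *m diagc pi *m (invmx (diagc (sV x)) *m invmx (diagc (sV x)))
      *m Vdot x.

Definition u_Stab K1 K2 Vstar x : 'cV[R]_n :=
  - Ls N *m K1 *m (sV x - Vstar) - Ls N *m K2 *m Vdot x + Vstar.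

Definition closed_loop pi K1 K2 Vstar mu x dx : Prop :=
  network_dynamics (Ls N *m mu + u_PBC pi x + u_Stab K1 K2 Vstar x) x dx.

Definition P_A x : R :=
  2^-1 * wnorm (invmx (Ls N)) (sV x) ^+ 2
  + 2^-1 * wnorm (invmx (Lt N)) (Rt N *m sIt x + Binc^T *m sV x) ^+ 2
  + 2^-1 * wnorm (invmx (Cs N))
             (sIs x + Binc *m sIt x - load_current (sV x)) ^+ 2.

Definition S_a K1 Vstar V : R :=
  2^-1 * wnorm K1 (V - Vstar) ^+ 2
  - (V^T *m invmx (Ls N) *m Vstar) 0 0
  + 2^-1 * wnorm (invmx (Ls N)) Vstar ^+ 2.

Definition S_d K1 Vstar x : R := P_A x + S_a K1 Vstar (sV x).

Definition supply_rate mu x : R := (mu^T *m Vdot x) 0 0.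

Definition It_bar Vstar : 'cV[R]_m := - (invmx (Rt N) *m Binc^T *m Vstar).

Definition Is_bar Vstar : 'cV[R]_n :=
  - (Binc *m It_bar Vstar) + ZlV N *m Vstar + Il N
  + invmx (diagc Vstar) *m Pl N.

End Network.

(* Main.v *)
(* With e = V - V*, v = dV/dt, w = R_t I_t + B^T V = - L_t dI_t/dt and
   y = I_s + B I_t - I_l(V) = C_s v, completing the square gives
     2 S_d = |e|^2_A + |w|^2_(L_t^-1) + |y|^2_(C_s^-1),   A = L_s^-1 + K1,
   and along the closed loop
     dS_d/dt = <mu, v> - |dI_t/dt|^2_(R_t) - |v|^2_G,
     dy/dt = mu - A e + B dI_t/dt - G v,
   with G = K2 + Z_l^-1 + (Pi - P_l) [V]^-2 >= K2. This is (i). For (ii), the map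
   (I_s, I_t, V) |-> (e, w, y) has a continuous inverse, so sublevel sets of S_d
   shrink to the equilibrium, which gives Lyapunov stability. Instead of LaSalle's
   principle, S_d is perturbed to S_d + eps <e, y>, whose derivative is negative
   definite in (e, dI_t/dt, v); it decays exponentially. A maximal solution
   trapped in a small ball is global by a Cauchy-Lipschitz argument, in which
   local solutions are limits of Euler polygons on dyadic grids. *)

Require Import Defs.
From mathcomp Require Import all_boot all_order all_algebra.
From mathcomp Require Import all_classical all_reals all_analysis.
From mathcomp Require Import ring lra.
Set Implicit Arguments.
Unset Strict Implicit.
Unset Printing Implicit Defensive.
Import Order.TTheory GRing.Theory Num.Theory.
Import numFieldNormedType.Exports.
Local Open Scope classical_set_scope.
Local Open Scope ring_scope.

(** * Euler polygons *)

(** [locally_attractive] speaks of maximal solutions and claims [T = +oo], so a bound on S_d is not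
    enough: a solution with finite horizon has to be continued. A limit at T is avoided by
    restarting shortly before T, with a step length that is uniform on the trapping ball, and gluing
    on the overlap. Existence and uniqueness rest on one estimate that replaces the integral
    equation, |z b - z a - (b - a) f (z a)| <= L M (b - a)^2. Euler limits inherit it, solutions
    satisfy it by the mean value inequality, two such curves with the same start coincide, and each
    of them is differentiable with derivative f. Dyadic refinement makes successive polygons differ
    by O(2^-k), a summable amount, so completeness suffices and no compactness argument enters. *)

(** Each of the j contributions b is amplified by at most (1 + a)^j <= exp (a j). *)
Lemma discrete_gronwall (R : realType) (a b : R) (d : nat -> R) (N : nat) :
  0 <= a -> 0 <= b -> d 0%N <= 0 ->
  (forall j, (j < N)%N -> d j.+1 <= (1 + a) * d j + b) ->
  forall j, (j <= N)%N -> d j <= j%:R * b * expR (a * j%:R).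
Proof.
move=> a0 b0 d0 dS; elim=> [|j IH] jN; first by rewrite !mul0r.
apply: le_trans (dS _ jN) _; have {}IH := IH (ltnW jN).
have e1 : 1 + a <= expR a := expR_ge1Dx a.
have E1 : 1 <= expR (a * j.+1%:R).
  by apply: le_trans (expR_ge1Dx _); rewrite lerDl mulr_ge0.
have jb : 0 <= j%:R * b by rewrite mulr_ge0.
have -> : j.+1%:R * b * expR (a * j.+1%:R)
    = expR a * (j%:R * b * expR (a * j%:R)) + b * expR (a * j.+1%:R).
  by rewrite -natr1 mulrDr mulr1 expRD; ring.
apply: lerD; last by rewrite ler_peMr.
apply: le_trans (_ : (1 + a) * (j%:R * b * expR (a * j%:R)) <= _).
  by rewrite ler_wpM2l// addr_ge0.
by rewrite ler_wpM2r// mulr_ge0// expR_ge0.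
Qed.

Section EulerScheme.
Variables (R : realType) (E : normedModType R) (f : E -> E).
Variables (x0 : E) (r M L : R).
Hypothesis L_ge0 : 0 <= L.
Hypothesis f_bnd : forall z, `|z - x0| <= r -> `|f z| <= M.
Hypothesis f_lip : forall z z', `|z - x0| <= r -> `|z' - x0| <= r ->
  `|f z - f z'| <= L * `|z - z'|.

Definition euler h z k : E := iter k (fun y => y + h *: f y) z.

Lemma eulerD h z i k : euler h z (i + k) = euler h (euler h z i) k.
Proof. by rewrite /euler addnC iterD. Qed.

(** The budget [c + k h M <= r] keeps all k steps in the ball where [f_bnd] applies. Starting at z
    instead of x0 makes the estimate usable in the middle of a polygon. *)
Lemma euler_dist h z k (c : R) : 0 <= h -> 0 <= M -> `|z - x0| <= c ->
  c + k%:R * h * M <= r -> `|euler h z k - z| <= k%:R * h * M.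
Proof.
move=> h0 M0 zc; elim: k => [|k IH] kr; first by rewrite subrr normr0 !mul0r.
have hM : 0 <= h * M by rewrite mulr_ge0.
have kr' : c + k%:R * h * M <= r by move: kr; rewrite -natr1; lra.
have {}IH := IH kr'.
have Br : `|euler h z k - x0| <= r.
  rewrite -(subrKA z); apply: le_trans (ler_normD _ _) _; lra.
rewrite /= addrAC; apply: le_trans (ler_normD _ _) _.
rewrite normrZ (ger0_norm h0) -natr1.
have : h * `|f (euler h z k)| <= h * M by rewrite ler_wpM2l ?f_bnd.
by rewrite /euler in IH *; lra.
Qed.

Lemma euler_ball h z k (c : R) : 0 <= h -> 0 <= M -> `|z - x0| <= c ->
  c + k%:R * h * M <= r -> `|euler h z k - x0| <= r.
Proof.
move=> h0 M0 zc kr; have kd := euler_dist h0 M0 zc kr.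
by rewrite -(subrKA z); apply: le_trans (ler_normD _ _) _; lra.
Qed.

(** Replacing the slope at step j by [f z] costs at most h L (j h M). The sum depends on k and h
    only through k h, which is why the bound survives the limit of vanishing mesh. *)
Lemma euler_taylor h z k (c : R) : 0 <= h -> 0 <= M -> `|z - x0| <= c ->
  c + k%:R * h * M <= r ->
  `|euler h z k - z - (k%:R * h) *: f z| <= L * M * (k%:R * h) ^+ 2.
Proof.
move=> h0 M0 zc; have hM : 0 <= h * M by rewrite mulr_ge0.
elim: k => [|k IH] kr; first by rewrite !mul0r scale0r !subrr normr0 expr0n mulr0.
have kr' : c + k%:R * h * M <= r by move: kr; rewrite -natr1; lra.
have {}IH := IH kr'.
have khM : 0 <= k%:R * h * M by rewrite !mulr_ge0.
rewrite [euler _ _ _]/= -/(euler h z k) -natr1 mulrDl mul1r scalerDl opprD.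
rewrite (addrAC (euler h z k)) addrACA -scalerBr.
apply: le_trans (ler_normD _ _) _; rewrite normrZ (ger0_norm h0).
have : h * `|f (euler h z k) - f z| <= h * (L * (k%:R * h * M)).
  rewrite ler_wpM2l//; apply: le_trans (f_lip _ _) _.
  - exact: euler_ball h0 M0 zc kr'.
  - lra.
  - by rewrite ler_wpM2l// (euler_dist h0 M0 zc).
have k0 : 0 <= k%:R :> R by [].
have : 0 <= L * M * (h * h) * (k%:R + 1) by rewrite !mulr_ge0// addr_ge0.
lra.
Qed.

(* Two steps of length h / 2 differ from one step of length h by O(h ^ 2). *)
Lemma euler_refine h k : 0 <= h -> 0 <= M -> k%:R * h * M <= r ->
  `|euler (h / 2) x0 k.*2 - euler h x0 k|
    <= k%:R * (L * M * h ^+ 2) * expR (L * h * k%:R).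
Proof.
move=> h0 M0 kr; have h20 : 0 <= h / 2 by lra.
have hM : 0 <= h * M by rewrite mulr_ge0.
pose d j := `|euler (h / 2) x0 j.*2 - euler h x0 j|.
apply: (@discrete_gronwall _ _ _ d k) (leqnn k).
- by rewrite mulr_ge0.
- by rewrite !mulr_ge0// exprn_ge0.
- by rewrite /d/= subrr normr0.
move=> j jk; rewrite /d doubleS -(addn2 j.*2) eulerD [euler h x0 j.+1]/= -/(euler h x0 j).
set y := euler _ _ j.*2; set z := euler h x0 j.
have jk' : j%:R * h * M + h * M <= r.
  apply: le_trans kr.
  have -> : j%:R * h * M + h * M = j.+1%:R * h * M by rewrite -natr1; ring.
  by rewrite -!mulrA ler_wpM2r// ler_nat.
have jE : j.*2%:R * (h / 2) * M = j%:R * h * M by rewrite -muln2 natrM; field.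
have x00 : `|x0 - x0| <= 0 by rewrite subrr normr0.
have yd : `|y - x0| <= j%:R * h * M.
  by rewrite -jE; apply: (euler_dist h20 M0 x00); rewrite jE; lra.
have zd : `|z - x0| <= j%:R * h * M.
  by apply: (euler_dist h0 M0 x00); lra.
have yT : `|euler (h / 2) y 2 - y - (2%:R * (h / 2)) *: f y|
    <= L * M * (2%:R * (h / 2)) ^+ 2.
  by apply: (euler_taylor h20 M0 yd); lra.
have h2E : 2%:R * (h / 2) = h by field.
rewrite h2E in yT.
(* The local error of two half steps from y, plus the previous distance carried through one full
   step, which gives the factor 1 + L h. *)
have -> : euler (h / 2) y 2 - (z + h *: f z)
    = (euler (h / 2) y 2 - y - h *: f y) + ((y - z) + h *: (f y - f z)).
  by rewrite scalerBr (addrACA y) -opprD -(addrA (euler _ y 2)) -opprD subrKA.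
apply: le_trans (ler_normD _ _) _.
rewrite addrC lerD//; apply: le_trans (ler_normD _ _) _.
rewrite mulrDl mul1r lerD// normrZ (ger0_norm h0) -mulrA mulrCA ler_wpM2l//.
by apply: f_lip; lra.
Qed.

End EulerScheme.

Lemma le_norm_lim (R : realType) (E : normedModType R) (u : nat -> E) (l : E)
    (v : nat -> R) (w : R) :
  u @ \oo --> l -> v @ \oo --> w -> (forall k, `|u k| <= v k) -> `|l| <= w.
Proof.
move=> ul vw uv; apply: ler_cvg_to (cvg_norm ul) vw _.
by near=> k; exact: uv.
Unshelve. all: by end_near. Qed.

(** * Dyadic grids *)

Section DyadicGrid.
Variable R : realType.
Implicit Type t : R.

Definition mesh k : R := 2^-1 ^+ k.
Definition grid k t : nat := Num.truncn (t * 2 ^+ k).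

Lemma mesh_gt0 k : 0 < mesh k.
Proof. by rewrite exprn_gt0// invr_gt0. Qed.

Lemma meshS k : mesh k.+1 = mesh k / 2.
Proof. by rewrite /mesh exprSr. Qed.

Lemma mesh_cvg0 : mesh @ \oo --> (0 : R).
Proof. by apply: cvg_expr; rewrite gtr0_norm; lra. Qed.

Lemma mul_mesh k : 2 ^+ k * mesh k = 1.
Proof. by rewrite -exprMn divff ?expr1n. Qed.

Lemma grid_le k t : 0 <= t -> (grid k t)%:R * mesh k <= t.
Proof.
move=> t0; have t2 : 0 <= t * 2 ^+ k by rewrite mulr_ge0// exprn_ge0.
have /andP[le _] := truncn_itv t2.
have {2}-> : t = t * 2 ^+ k * mesh k by rewrite -mulrA mul_mesh mulr1.
exact: (ler_wpM2r (ltW (mesh_gt0 k)) le).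
Qed.

Lemma grid_gt k t : 0 <= t -> t - mesh k <= (grid k t)%:R * mesh k.
Proof.
move=> t0; have t2 : 0 <= t * 2 ^+ k by rewrite mulr_ge0// exprn_ge0.
have /andP[_ lt] := truncn_itv t2.
have : t * 2 ^+ k * mesh k <= (grid k t).+1%:R * mesh k.
  by rewrite ler_wpM2r ?(ltW lt)// (ltW (mesh_gt0 k)).
by rewrite -mulrA mul_mesh -natr1; lra.
Qed.

Lemma grid_homo k t t' : t <= t' -> (grid k t <= grid k t')%N.
Proof. by move=> tt; rewrite le_truncn// ler_wpM2r// exprn_ge0. Qed.

(** The integer part of 2 s is twice that of s, or one more: at time t the finer polygon makes two
    half steps for each coarse step and then at most one extra half step. *)
Lemma gridS k t : 0 <= t ->
  grid k.+1 t = (grid k t).*2 \/ grid k.+1 t = (grid k t).*2.+1.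
Proof.
move=> t0; have t2 j : 0 <= t * 2 ^+ j by rewrite mulr_ge0// exprn_ge0.
have /andP[lo hi] := truncn_itv (t2 k).
have ge2 : ((grid k t).*2 <= grid k.+1 t)%N.
  rewrite truncn_ge_nat// -muln2 natrM exprSr mulrA ler_pM2r//.
have le2 : (grid k.+1 t < (grid k t).*2.+2)%N.
  by rewrite truncn_lt_nat// -doubleS -muln2 natrM exprSr mulrA ltr_pM2r.
have [->|ne] := eqVneq (grid k.+1 t) (grid k t).*2; first by left.
right; apply/eqP; rewrite eqn_leq -ltnS le2 /=.
by rewrite ltn_neqAle eq_sym ne.
Qed.

Lemma grid_cvg t : 0 <= t -> (grid k t)%:R * mesh k @[k --> \oo] --> t.
Proof.
move=> t0; apply: (@squeeze_cvgr _ _ _ _ (fun k => t - mesh k) (cst t)).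
- by near=> k; rewrite grid_gt// grid_le.
- by rewrite -[X in _ --> X]subr0; apply: cvgB; [exact: cvg_cst|exact: mesh_cvg0].
- exact: cvg_cst.
Unshelve. all: by end_near. Qed.

End DyadicGrid.

(** * The limit of the Euler polygons *)

Section EulerFlow.
Variables (R : realType) (E : normedModType R) (f : E -> E).
Variables (x0 : E) (r M L delta : R).
(** Completeness in the form in which it is used. [E] carries only a norm here;
    [state_summable_steps_cvg] provides this property for the network states. *)
Hypothesis E_complete : forall u : nat -> E,
  cvgn (series (fun k => `|u k.+1 - u k|)) -> cvgn u.
Hypothesis L_ge0 : 0 <= L.
Hypothesis M_ge0 : 0 <= M.
Hypothesis delta_ge0 : 0 <= delta.
Hypothesis delta_r : delta * M <= r.
Hypothesis f_bnd : forall z, `|z - x0| <= r -> `|f z| <= M.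
Hypothesis f_lip : forall z z', `|z - x0| <= r -> `|z' - x0| <= r ->
  `|f z - f z'| <= L * `|z - z'|.

Let polygon k (t : R) : E := euler f (mesh R k) x0 (grid k t).

Let x0x0 : `|x0 - x0| <= 0. Proof. by rewrite subrr normr0. Qed.

Let mesh0 k : 0 <= mesh R k. Proof. exact: ltW (mesh_gt0 R k). Qed.

Let grid_r k t : 0 <= t <= delta -> (grid k t)%:R * mesh R k * M <= r.
Proof.
move=> /andP[t0 td]; apply: le_trans delta_r.
by rewrite ler_wpM2r// (le_trans (grid_le _ t0)).
Qed.

Let polygon_ball k t : 0 <= t <= delta -> `|polygon k t - x0| <= r.
Proof.
move=> t0; apply: (euler_ball f_bnd (mesh0 k) M_ge0 x0x0).
by rewrite add0r grid_r.
Qed.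

(** At most delta / mesh steps, each with defect O(mesh^2), add up to O(mesh); the possible extra
    half step is also O(mesh). The bound is geometric in k, hence summable. *)
Let polygon_cauchy k t : 0 <= t <= delta ->
  `|polygon k.+1 t - polygon k t|
    <= (delta * (L * M) * expR (L * delta) + M) * mesh R k.
Proof.
move=> t0d; have /andP[t0 td] := t0d; have h0 := mesh0 k.
have gd : (grid k t)%:R * mesh R k <= delta by exact: le_trans (grid_le _ t0) td.
have ref : `|euler f (mesh R k / 2) x0 (grid k t).*2 - polygon k t|
    <= delta * (L * M) * expR (L * delta) * mesh R k.
  apply: le_trans (euler_refine L_ge0 f_bnd f_lip h0 M_ge0 (grid_r k t0d)) _.
  set g := (grid k t)%:R in gd *; have g0 : 0 <= g by [].
  have -> : g * (L * M * mesh R k ^+ 2) * expR (L * mesh R k * g)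
      = g * mesh R k * (L * M) * expR (L * (g * mesh R k)) * mesh R k.
    by rewrite (_ : L * mesh R k * g = L * (g * mesh R k)); ring.
  rewrite ler_wpM2r// ler_pM ?mulr_ge0 ?expR_ge0//.
    by rewrite ler_wpM2r// mulr_ge0.
  by rewrite ler_expR ler_wpM2l.
have [gE|gE] := gridS k t0; rewrite /polygon meshS gE.
  by apply: le_trans ref _; rewrite ler_wpM2r// lerDl.
(* Odd case: the extra half step has length at most [mesh k / 2 * M]. *)
rewrite -(addn1 (grid k t).*2) eulerD /=; set y := euler f _ x0 _; rewrite addrAC.
apply: le_trans (ler_normD _ _) _; rewrite mulrDl lerD//.
have yB : `|y - x0| <= r.
  have h20 : 0 <= mesh R k / 2 by rewrite divr_ge0.
  apply: (euler_ball f_bnd h20 M_ge0 x0x0); rewrite add0r.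
  by have := grid_r k t0d; rewrite -muln2 natrM; lra.
rewrite normrZ ger0_norm ?divr_ge0// mulrC.
apply: ler_pM => //; [by rewrite divr_ge0|exact: f_bnd|by lra].
Qed.

Let polygon_cvg t : 0 <= t <= delta -> cvgn (polygon ^~ t).
Proof.
move=> t0; apply: E_complete.
pose C := delta * (L * M) * expR (L * delta) + M.
apply: (@series_le_cvg _ _ (geometric C 2^-1)) => [k|k|k|].
- exact: normr_ge0.
- by rewrite /= mulr_ge0 ?addr_ge0 ?mulr_ge0 ?expR_ge0// exprn_ge0// invr_ge0.
- exact: polygon_cauchy.
- by apply: is_cvg_geometric_series; rewrite gtr0_norm; lra.
Qed.

(* For a <= b the polygon from a to b consists of full steps, hence the Taylor
   estimate euler_taylor passes to the limit. *)
Lemma euler_flow : exists z : R -> E, [/\ z 0 = x0,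
  forall t, 0 <= t <= delta -> `|z t - x0| <= r,
  forall a b, 0 <= a -> a <= b -> b <= delta -> `|z b - z a| <= (b - a) * M &
  forall a b, 0 <= a -> a <= b -> b <= delta ->
    `|z b - z a - (b - a) *: f (z a)| <= L * M * (b - a) ^+ 2].
Proof.
pose z (t : R) : E := limn (polygon ^~ t); exists z.
have zE t : 0 <= t <= delta -> polygon ^~ t @ \oo --> z t by exact: polygon_cvg.
have zB t : 0 <= t <= delta -> `|z t - x0| <= r.
  move=> t0; apply: (@le_norm_lim _ _ (fun k => polygon k t - x0) _ (cst r)).
  - by apply: cvgB; [exact: zE|exact: cvg_cst].
  - exact: cvg_cst.
  - by move=> k; exact: polygon_ball.
pose p k (t : R) : R := (grid k t)%:R * mesh R k.
have pg t : 0 <= t -> p ^~ t @ \oo --> t by exact: grid_cvg.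
have step k a b : 0 <= a -> a <= b -> b <= delta -> exists n,
    [/\ polygon k b = euler f (mesh R k) (polygon k a) n,
       n%:R * mesh R k = p k b - p k a, `|polygon k a - x0| <= p k a * M &
       p k a * M + n%:R * mesh R k * M <= r].
  move=> a0 ab bd; exists (grid k b - grid k a)%N.
  have g := grid_homo k ab; have nE : (grid k b - grid k a)%:R * mesh R k = p k b - p k a.
    by rewrite natrB// mulrBl.
  split=> //.
  - by rewrite /polygon -eulerD subnKC.
  - apply: (euler_dist f_bnd (mesh0 k) M_ge0 x0x0); rewrite add0r grid_r//.
    by rewrite a0 (le_trans ab).
  - by rewrite nE -mulrDl addrC subrK grid_r// bd (le_trans a0).
split.
- rewrite /z; apply/cvg_lim => //; rewrite /polygon/=.
  have -> : (fun k => euler f (mesh R k) x0 (grid k (0 : R))) = cst x0.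
    by apply: boolp.funext => k; rewrite /grid mul0r truncn0.
  exact: cvg_cst.
- exact: zB.
- move=> a b a0 ab bd.
  have zb : polygon ^~ b @ \oo --> z b by apply: zE; rewrite bd (le_trans a0).
  have za : polygon ^~ a @ \oo --> z a by apply: zE; rewrite a0 (le_trans ab).
  apply: (@le_norm_lim _ _ (fun k => polygon k b - polygon k a) _
    (fun k => (p k b - p k a) * M)).
  + exact: cvgB zb za.
  + by apply: cvgMl; apply: cvgB; apply: pg => //; exact: le_trans a0 ab.
  + move=> k; have [n [-> <- aM nr]] := step k a b a0 ab bd.
    exact: (euler_dist f_bnd (mesh0 k) M_ge0 aM nr).
- move=> a b a0 ab bd.
  have zb : polygon ^~ b @ \oo --> z b by apply: zE; rewrite bd (le_trans a0).
  have a0d : 0 <= a <= delta by rewrite a0 (le_trans ab).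
  have za : polygon ^~ a @ \oo --> z a by exact: zE.
  have pc : p k b - p k a @[k --> \oo] --> b - a.
    by apply: cvgB; apply: pg => //; exact: le_trans a0 ab.
  have fa : f (polygon k a) @[k --> \oo] --> f (z a).
    apply/subr_cvg0; apply/norm_cvg0P.
    apply: (@squeeze_cvgr _ _ _ _ (cst 0) (fun k => L * `|polygon k a - z a|)).
    - by near=> k; rewrite normr_ge0 /= f_lip ?polygon_ball ?zB.
    - exact: cvg_cst.
    - rewrite -(mulr0 L); apply: cvgMr; apply/norm_cvg0P/subr_cvg0; exact: za.
  apply: (@le_norm_lim _ _
    (fun k => polygon k b - polygon k a - (p k b - p k a) *: f (polygon k a)) _
    (fun k => L * M * (p k b - p k a) ^+ 2)).
  + by apply: cvgB; [exact: cvgB zb za|exact: cvgZ pc fa].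
  + by apply: cvgMr; rewrite !expr2; exact: (cvgM pc pc).
  + move=> k; have [n [-> <- aM nr]] := step k a b a0 ab bd.
    exact: (euler_taylor L_ge0 f_bnd f_lip (mesh0 k) M_ge0 aM nr).
Unshelve. all: by end_near. Qed.
End EulerFlow.

(* Both curves have Taylor defect O((b - a) ^ 2), so on a grid with N steps
   their distance obeys a discrete Gronwall inequality with total error O(1/N). *)
Lemma taylor_curve_unique (R : realType) (E : normedModType R) (f : E -> E)
    (B : set E) (L C T : R) (x y : R -> E) :
  0 <= L -> 0 <= C -> 0 <= T ->
  (forall z z', B z -> B z' -> `|f z - f z'| <= L * `|z - z'|) ->
  (forall t, 0 <= t <= T -> B (x t)) -> (forall t, 0 <= t <= T -> B (y t)) ->
  (forall a b, 0 <= a -> a <= b -> b <= T ->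
    `|x b - x a - (b - a) *: f (x a)| <= C * (b - a) ^+ 2) ->
  (forall a b, 0 <= a -> a <= b -> b <= T ->
    `|y b - y a - (b - a) *: f (y a)| <= C * (b - a) ^+ 2) ->
  x 0 = y 0 -> x T = y T.
Proof.
move=> L0 C0 T0 fL Bx By xT yT xy0.
have bnd n : `|x T - y T| <= C * 2 * T ^+ 2 * expR (L * T) * n.+1%:R^-1.
  pose h := T / n.+1%:R; have h0 : 0 <= h by rewrite divr_ge0.
  have hn : h * n.+1%:R = T by rewrite divfK// pnatr_eq0.
  pose d j := `|x (j%:R * h) - y (j%:R * h)|.
  suff dn : d n.+1 <= n.+1%:R * (2 * C * h ^+ 2) * expR (L * h * n.+1%:R).
    move: dn; rewrite /d -(mulrA L) (mulrC n.+1%:R h) hn => dn.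
    apply: le_trans dn _; rewrite le_eqVlt; apply/orP; left; apply/eqP.
    by rewrite /h; field; rewrite nat1r pnatr_eq0.
  apply: (@discrete_gronwall _ _ _ d n.+1) (leqnn _).
  - by rewrite mulr_ge0.
  - by rewrite !mulr_ge0.
  - by rewrite /d mul0r xy0 subrr normr0.
  - move=> j jn; rewrite /d; have j0 : 0 <= j%:R * h by rewrite mulr_ge0.
    have jj : j%:R * h <= j.+1%:R * h by rewrite ler_wpM2r// ler_nat.
    have jT : j.+1%:R * h <= T by rewrite -hn mulrC ler_wpM2l// ler_nat.
    have jh : j.+1%:R * h - j%:R * h = h by rewrite -natr1; ring.
    have := xT _ _ j0 jj jT; have := yT _ _ j0 jj jT; rewrite jh.
    have jB : 0 <= j%:R * h <= T by rewrite j0 (le_trans jj).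
    have := fL _ _ (Bx _ jB) (By _ jB).
    set x1 := x (_.+1%:R * h); set y1 := y (_.+1%:R * h).
    set xj := x _; set yj := y _ => fd ey ex.
    have -> : x1 - y1 = (x1 - xj - h *: f xj) - (y1 - yj - h *: f yj)
        + ((xj - yj) + h *: (f xj - f yj)).
      rewrite scalerBr (addrACA xj) -opprD -(addrA x1) -(addrA y1) -!opprD.
      by rewrite (opprD y1) (addrACA x1) -(opprD (xj + _)) subrK.
    apply: le_trans (ler_normD _ _) _.
    have := ler_normB (x1 - xj - h *: f xj) (y1 - yj - h *: f yj).
    have := ler_normD (xj - yj) (h *: (f xj - f yj)).
    rewrite normrZ (ger0_norm h0).
    have : h * `|f xj - f yj| <= h * (L * `|xj - yj|) by rewrite ler_wpM2l.
    lra.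
apply/eqP; rewrite -subr_eq0 -normr_le0.
apply: (@ler_cvg_to _ \oo _ _ (cst `|x T - y T|)
  (fun n => C * 2 * T ^+ 2 * expR (L * T) * n.+1%:R^-1)).
- exact: cvg_cst.
- rewrite -[X in _ --> X](mulr0 (C * 2 * T ^+ 2 * expR (L * T))).
  by apply: cvgMr; exact: cvg_harmonic.
- by near=> n; exact: bnd.
Unshelve. all: by end_near. Qed.

(** * Derivatives relative to a set *)

Section MatrixConvergence.
Variables (R : realType) (T : Type) (F : set_system T).
Context {FF : Filter F}.

Lemma cvg_mxP p q (f : T -> 'M[R]_(p, q)) (l : 'M[R]_(p, q)) :
  f @ F --> l <-> forall i j, f x i j @[x --> F] --> l i j.
Proof.
split=> [fl i j|fl].
  by move=> P /(@coord_continuous R p q i j l) lP; exact: (fl _ lP).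
apply/(@cvg_mx_entourageP (R : puniformType) p q (f @ F)) => A entA.
have : \forall x \near F, forall ij : 'I_p * 'I_q, A (l ij.1 ij.2, f x ij.1 ij.2).
  apply: filter_forall => ij.
  by have /cvg_app_entourageP := fl ij.1 ij.2; exact.
by apply: filterS => x Ax i j; rewrite inE; exact: (Ax (i, j)).
Qed.

Lemma cvg_mulmx p q r (f : T -> 'M[R]_(p, q)) (g : T -> 'M[R]_(q, r)) (a : 'M[R]_(p, q)) (b : 'M[R]_(q, r)) :
  f @ F --> a -> g @ F --> b -> f x *m g x @[x --> F] --> a *m b.
Proof.
move=> /cvg_mxP fa /cvg_mxP gb; apply/cvg_mxP => i j; rewrite mxE.
under eq_fun do rewrite mxE.
by apply: cvg_big => [|k _]; [exact: add_continuous|exact: cvgM].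
Qed.

Lemma cvg_trmx p q (f : T -> 'M[R]_(p, q)) (a : 'M[R]_(p, q)) :
  f @ F --> a -> (f x)^T @[x --> F] --> a^T.
Proof.
move=> /cvg_mxP fa; apply/cvg_mxP => i j; rewrite mxE.
by under eq_fun do rewrite mxE; exact: fa.
Qed.

End MatrixConvergence.

Section DeriveWithin.
Variables (R : realType) (J : set R) (t : R).
Implicit Types E : normedModType R.

(** Multiplying the difference quotient by [s - t] removes the division, and the excluded point s =
    t becomes harmless. *)
Lemma is_derive_withinP E (x : R -> E) dx : is_derive_within J x t dx <->
  forall eps, 0 < eps -> exists2 d, 0 < d & forall s, J s -> `|s - t| < d ->
    `|x s - x t - (s - t) *: dx| <= eps * `|s - t|.
Proof.
split.
  move=> /cvgrPdist_le xd eps e0; have /nbhs_ballP[d d0 dP] := xd eps e0.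
  exists d => // s Js std; have [->|st] := eqVneq s t.
    by rewrite !subrr scale0r subr0 !normr0 mulr0.
  have st0 : s - t != 0 by rewrite subr_eq0.
  have bst : ball (0 : R) d (s - t) by rewrite /ball /= sub0r normrN.
  have := dP _ bst st0; rewrite /= [t + _]addrC subrK => /(_ Js).
  rewrite distrC -(ler_pM2r (_ : 0 < `|s - t|)) ?normr_gt0// [_ * `|_|]mulrC.
  by rewrite -normrZ scalerBr scalerA divff// scale1r.
move=> xd; apply/cvgrPdist_le => eps e0; have [d d0 dP] := xd eps e0.
apply/nbhs_ballP; exists d => // h; rewrite /ball/= sub0r normrN => hd h0 Jh.
have hE : t + h - t = h by rewrite addrC addKr.
have := dP _ Jh; rewrite hE => /(_ hd); rewrite distrC.
rewrite -(ler_pM2l (_ : 0 < `|h^-1|)) ?normr_gt0 ?invr_eq0// -normrZ.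
rewrite scalerBr scalerA mulVf// scale1r mulrCA -normrM mulVf// normr1 mulr1.
by [].
Qed.

Lemma is_derive_within_cvg E (x : R -> E) dx : is_derive_within J x t dx ->
  x (t + h) @[h --> within [set h | J (t + h)] 0^'] --> x t.
Proof.
move=> xd; apply/subr_cvg0.
apply: (@cvg_trans _ (h *: (h^-1 *: (x (t + h) - x t))
    @[h --> within [set h | J (t + h)] 0^'])).
  apply: near_eq_cvg; near=> h; rewrite scalerA divff ?scale1r//.
  by near: h; apply: cvg_within; apply: withinT.
rewrite -(scale0r dx); apply: cvgZ xd.
by apply: cvg_trans (cvg_within _) _; apply: cvg_trans (@nbhs_dnbhs _ _) _ => //.
Unshelve. all: by end_near. Qed.

Lemma is_derive_withinD E (x y : R -> E) dx dy :
  is_derive_within J x t dx -> is_derive_within J y t dy ->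
  is_derive_within J (fun s => x s + y s) t (dx + dy).
Proof.
move=> xd yd; rewrite /is_derive_within.
under eq_fun do rewrite opprD addrACA scalerDr.
exact: (cvgD xd yd).
Qed.

Lemma is_derive_withinN E (x : R -> E) dx :
  is_derive_within J x t dx -> is_derive_within J (fun s => - x s) t (- dx).
Proof.
move=> xd; rewrite /is_derive_within.
under eq_fun do rewrite -opprD scalerN.
exact: (cvgN xd).
Qed.

Lemma is_derive_withinB E (x y : R -> E) dx dy :
  is_derive_within J x t dx -> is_derive_within J y t dy ->
  is_derive_within J (fun s => x s - y s) t (dx - dy).
Proof.
by move=> xd yd; apply: is_derive_withinD => //; exact: is_derive_withinN.
Qed.

Lemma is_derive_within_cst E (a : E) : is_derive_within J (fun=> a) t 0.
Proof.
rewrite /is_derive_within; under eq_fun do rewrite subrr scaler0.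
exact: cvg_cst.
Qed.

(** A single Leibniz rule, instantiated below to products of reals, of matrices, and of a real with
    a vector. The premise on filters is joint continuity of [op]. *)
Lemma is_derive_within_bilinear (E1 E2 E3 : normedModType R)
    (op : E1 -> E2 -> E3) (x : R -> E1) (y : R -> E2) dx dy :
  (forall a b c, op (a - b) c = op a c - op b c) ->
  (forall a b c, op a (b - c) = op a b - op a c) ->
  (forall k a b, op (k *: a) b = k *: op a b) ->
  (forall k a b, op a (k *: b) = k *: op a b) ->
  (forall (F : set_system R) (f : R -> E1) (g : R -> E2) a b, Filter F ->
    f @ F --> a -> g @ F --> b -> op (f s) (g s) @[s --> F] --> op a b) ->
  is_derive_within J x t dx -> is_derive_within J y t dy ->
  is_derive_within J (fun s => op (x s) (y s)) t (op dx (y t) + op (x t) dy).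
Proof.
move=> opBl opBr opZl opZr opc xd yd.
have yc := is_derive_within_cvg yd.
rewrite /is_derive_within.
have eqf h : h^-1 *: (op (x (t + h)) (y (t + h)) - op (x t) (y t))
    = op (h^-1 *: (x (t + h) - x t)) (y (t + h))
      + op (x t) (h^-1 *: (y (t + h) - y t)).
  by rewrite opZl opZr opBl opBr -scalerDr subrKA.
under eq_fun do rewrite eqf.
apply: cvgD; first exact: (opc _ _ _ _ _ _ xd yc).
by apply: opc yd; exact: cvg_cst.
Qed.

Lemma is_derive_withinM (x y : R -> R) dx dy :
  is_derive_within J x t dx -> is_derive_within J y t dy ->
  is_derive_within J (fun s => x s * y s) t (dx * y t + x t * dy).
Proof.
apply: (@is_derive_within_bilinear R^o R^o R^o *%R).
- by move=> a b c; exact: mulrBl.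
- by move=> a b c; exact: mulrBr.
- by move=> k a b; exact: (esym (mulrA _ _ _)).
- by move=> k a b; exact: mulrCA.
- by move=> F f g a b FF fa gb; exact: (cvgM fa gb).
Qed.

Lemma is_derive_within_mulmx p q r (x : R -> 'M[R]_(p, q))
    (y : R -> 'M[R]_(q, r)) dx dy :
  is_derive_within J x t dx -> is_derive_within J y t dy ->
  is_derive_within J (fun s => x s *m y s) t (dx *m y t + x t *m dy).
Proof.
apply: is_derive_within_bilinear.
- by move=> *; rewrite mulmxBl.
- by move=> *; rewrite mulmxBr.
- by move=> *; rewrite scalemxAl.
- by move=> *; rewrite scalemxAr.
- by move=> F f g a b FF fa gb; exact: cvg_mulmx.
Qed.

Lemma is_derive_within_mulmxl p q r (A : 'M[R]_(p, q)) (y : R -> 'M[R]_(q, r)) dy :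
  is_derive_within J y t dy -> is_derive_within J (fun s => A *m y s) t (A *m dy).
Proof.
move=> /(is_derive_within_mulmx (is_derive_within_cst A)).
by rewrite mul0mx add0r.
Qed.

Lemma is_derive_within_trmx p q (x : R -> 'M[R]_(p, q)) dx :
  is_derive_within J x t dx -> is_derive_within J (fun s => (x s)^T) t dx^T.
Proof.
move=> /cvg_trmx; apply: cvg_trans; apply: near_eq_cvg; near=> h.
by rewrite linearZ linearB.
Unshelve. all: by end_near. Qed.

Lemma is_derive_within_mxP p q (x : R -> 'M[R]_(p, q)) dx :
  is_derive_within J x t dx <->
  forall i j, is_derive_within J (fun s => x s i j) t (dx i j).
Proof.
rewrite /is_derive_within; rewrite cvg_mxP.
have eqf i j : (fun h => (h^-1 *: (x (t + h) - x t)) i j)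
    = (fun h => h^-1 *: (x (t + h) i j - x t i j)).
  by apply/funext => h; rewrite !mxE.
by split=> xd i j; have := xd i j; rewrite eqf.
Qed.

Lemma is_derive_withinV (x : R -> R) dx : x t != 0 ->
  is_derive_within J x t dx ->
  is_derive_within J (fun s => (x s)^-1) t (- (x t)^-1 * dx * (x t)^-1).
Proof.
move=> xt0 xd; have xc := is_derive_within_cvg xd.
have xVc : (x (t + h))^-1 @[h --> within [set h | J (t + h)] 0^'] --> (x t)^-1.
  exact: cvgV.
have xdM : h^-1 * (x (t + h) - x t)
    @[h --> within [set h | J (t + h)] 0^'] --> dx by exact: xd.
have : - (x (t + h))^-1 * (h^-1 * (x (t + h) - x t)) * (x t)^-1
    @[h --> within [set h | J (t + h)] 0^'] --> - (x t)^-1 * dx * (x t)^-1.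
  exact: (cvgM (cvgM (cvgN xVc) xdM) (cvg_cst _)).
apply: cvg_trans; apply: near_eq_cvg; near=> h.
have xh0 : x (t + h) != 0.
  by near: h; exact: (cvgr_neq0 _ xc).
rewrite /GRing.scale/=; set k := h^-1; field.
by rewrite xt0 xh0.
Unshelve. all: by end_near. Qed.

Lemma is_derive_within_id : is_derive_within J id t 1.
Proof.
apply/is_derive_withinP => eps e0; exists 1 => // s _ _.
by rewrite /= /GRing.scale/= mulr1 subrr normr0 mulr_ge0// ltW.
Qed.

Lemma is_derive_is_derive_within (x : R -> R) dx :
  is_derive t 1 x dx -> is_derive_within J x t dx.
Proof.
move=> xd.
have xl : h^-1 *: ((x \o shift t) (h *: 1) - x t) @[h --> 0^'] --> dx.
  by case: xd => xd <-; exact: xd.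
move=> P /xl H; rewrite /nbhs/= /within/=; near=> h => _.
have : P (h^-1 *: ((x \o shift t) (h *: 1) - x t)) by near: h; exact: H.
by rewrite /= [_%:A]mulr1 (addrC t).
Unshelve. all: by end_near.
Qed.

Lemma is_derive_within_is_derive (x : R -> R) dx : nbhs t J ->
  is_derive_within J x t dx -> is_derive t 1 x dx.
Proof.
move=> Jt xd.
suff xl : h^-1 *: ((x \o shift t) (h *: 1) - x t) @[h --> 0^'] --> dx.
  by split; [apply/cvg_ex; exists dx|exact/cvg_lim].
have J0 : \forall h \near (0 : R)^', J (t + h).
  apply: nbhs_dnbhs; have := Jt; rewrite -{1}(addr0 t).
  exact: (cvgD (cvg_cst t) cvg_id).
move=> P /xd H; rewrite /nbhs/=; near=> h.
have Jh : J (t + h) by near: h; exact: J0.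
have : J (t + h) -> P (h^-1 *: (x (t + h) - x t)) by near: h; exact: H.
by move=> /(_ Jh); rewrite /= [_%:A]mulr1 (addrC t).
Unshelve. all: by end_near.
Qed.

End DeriveWithin.

(** * Monotonicity and the mean value inequality on a horizon *)

Section Horizon.
Variables (R : realType) (T : \bar R).
Local Notation H := (horizon T).

Lemma horizon_le (s t : R) : H t -> 0 <= s -> s <= t -> H s.
Proof. by move=> [t0 tT] s0 st; split=> //; exact: le_lt_trans tT. Qed.

Lemma nbhs_horizon (t : R) : 0 < t -> (t%:E < T)%E -> nbhs t H.
Proof.
move=> t0 tT; have TT : \forall s \near t, (s%:E < T)%E.
  case: T tT => [r|_|//]; last by near=> s; exact: ltry.
  by rewrite lte_fin => tr; near do rewrite lte_fin; exact: lt_nbhsl.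
near=> s; split; last by near: s.
by apply: ltW; near: s; exact: lt_nbhsr.
Unshelve. all: by end_near. Qed.

(** In the interior of the horizon the relative derivative is the ordinary one, so the classical
    criterion applies on ]a, b[. At the ends, where a may be 0, one-sided continuity suffices, and
    it follows from the relative derivative. *)
Lemma le_derive_within_le0 (g : R -> R) (a b : R) : 0 <= a -> a <= b -> H b ->
  (forall t, a <= t <= b -> exists2 dg, is_derive_within H g t dg & dg <= 0) ->
  g b <= g a.
Proof.
move=> a0; rewrite le_eqVlt => /orP[/eqP ->//|ab] Hb gd.
have Hab t : a <= t <= b -> H t.
  by move=> /andP[at_ tb]; apply: horizon_le Hb _ tb; exact: le_trans at_.
have itvW t : t \in `]a, b[ -> a <= t <= b.
  by rewrite in_itv /= => /andP[/ltW -> /ltW ->].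
have int t : t \in `]a, b[ -> exists2 dg, is_derive t 1 g dg & dg <= 0.
  move=> tab; have [dg gdg dg0] := gd _ (itvW _ tab); exists dg => //.
  apply: is_derive_within_is_derive gdg; move: tab; rewrite in_itv/= => /andP[at_ tb].
  apply: nbhs_horizon; first exact: le_lt_trans at_.
  by case: Hb => _; apply: lt_trans; rewrite lte_fin.
have gcont (t : R) : a <= t <= b -> forall e, 0 < e ->
    \forall s \near t, H s -> `|g t - g s| <= e.
  move=> tab e e0; have [dg gdg _] := gd _ tab.
  (* With tolerance 1 the expansion gives |g s - g t| <= (1 + |dg|) |s - t| near t. *)
  have [d d0 dP] := (is_derive_withinP _ _ _ _).1 gdg 1 ltr01.
  near=> s => Hs; rewrite distrC.
  have std : `|s - t| < d.
    by rewrite distrC; near: s; exact: (nbhsx_ballx t d d0).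
  have ste : `|s - t| * (1 + `|dg|) <= e.
    rewrite -ler_pdivlMr ?ltr_pwDl// distrC; apply: ltW; near: s.
    by apply: nbhsx_ballx; rewrite divr_gt0 ?ltr_pwDl.
  have := dP s Hs std; rewrite mul1r => ds; apply: le_trans ste.
  rewrite -[X in `|X|](subrK ((s - t) *: dg)); apply: le_trans (ler_normD _ _) _.
  by rewrite mulrDr mulr1 lerD// normrM.
have : {in `[a, b] &, {homo g : x y /~ x <= y}}.
  apply: ler0_derive1_le_cc.
  - by move=> t /int[dg []].
  - by move=> t /int[dg gdg dg0]; rewrite derive1E (@derive_val _ _ _ _ _ _ _ gdg).
  apply/continuous_within_itvP => //; split.
  - move=> t /int[dg gdg _]; apply: differentiable_continuous.
    by apply/derivable1_diffP; case: gdg.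
  - apply/cvgrPdist_le => e e0; near=> s.
    have : H s -> `|g a - g s| <= e.
      near: s; apply: cvg_within; apply: gcont => //; first by rewrite lexx ltW.
    apply; apply: Hab; apply/andP; split; last by near: s; exact: nbhs_right_le.
    by near: s; exact: nbhs_right_ge.
  - apply/cvgrPdist_le => e e0; near=> s.
    have : H s -> `|g b - g s| <= e.
      near: s; apply: cvg_within; apply: gcont => //; first by rewrite lexx ltW.
    apply; apply: Hab; apply/andP; split; first by near: s; exact: nbhs_left_ge.
    by near: s; exact: nbhs_left_le.
by apply; rewrite ?in_itv/= ?lexx ?ltW.
Unshelve. all: by end_near. Qed.

(** Both [g s - s * M] and [- g s - s * M] are nonincreasing. *)
Lemma le_norm_derive_within (g : R -> R) (a b M : R) : 0 <= a -> a <= b -> H b ->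
  (forall t, a <= t <= b -> exists2 dg, is_derive_within H g t dg & `|dg| <= M) ->
  `|g b - g a| <= (b - a) * M.
Proof.
move=> a0 ab Hb gd.
have Mid t : is_derive_within H (fun s => s * M) t M.
  have := is_derive_withinM (@is_derive_within_id _ H t) (is_derive_within_cst H t M).
  by rewrite mul1r mulr0 addr0.
have up : g b - b * M <= g a - a * M.
  apply: (@le_derive_within_le0 (fun s => g s - s * M)) => // t /gd[dg gdg dgM].
  by exists (dg - M); [exact: is_derive_withinB|rewrite subr_le0 (le_trans (ler_norm _))].
have lo : - g b - b * M <= - g a - a * M.
  apply: (@le_derive_within_le0 (fun s => - g s - s * M)) => // t /gd[dg gdg dgM].
  exists (- dg - M); first by apply: is_derive_withinB => //; exact: is_derive_withinN.
  by rewrite subr_le0 (le_trans (ler_norm _))// normrN.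
by rewrite ler_norml; apply/andP; split; lra.
Qed.

End Horizon.

(** * Quadratic forms *)

Section Dot.
Variable R : realType.

Definition dot n (a b : 'cV[R]_n) : R := (a^T *m b) 0 0.

Lemma dotE n (a b : 'cV[R]_n) : dot a b = \sum_i a i 0 * b i 0.
Proof. by rewrite /dot mxE; apply: eq_bigr => i _; rewrite mxE. Qed.

Lemma dotC n (a b : 'cV[R]_n) : dot a b = dot b a.
Proof. by rewrite !dotE; apply: eq_bigr => i _; rewrite mulrC. Qed.

Lemma dotDl n (a b c : 'cV[R]_n) : dot (a + b) c = dot a c + dot b c.
Proof. by rewrite /dot linearD mulmxDl mxE. Qed.

Lemma dotNl n (a b : 'cV[R]_n) : dot (- a) b = - dot a b.
Proof. by rewrite /dot linearN mulNmx mxE. Qed.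

Lemma dotBl n (a b c : 'cV[R]_n) : dot (a - b) c = dot a c - dot b c.
Proof. by rewrite dotDl dotNl. Qed.

Lemma dotZl n k (a b : 'cV[R]_n) : dot (k *: a) b = k * dot a b.
Proof. by rewrite /dot linearZ -scalemxAl mxE. Qed.

Lemma dotDr n (a b c : 'cV[R]_n) : dot c (a + b) = dot c a + dot c b.
Proof. by rewrite dotC dotDl !(dotC c). Qed.

Lemma dotNr n (a b : 'cV[R]_n) : dot b (- a) = - dot b a.
Proof. by rewrite dotC dotNl dotC. Qed.

Lemma dotBr n (a b c : 'cV[R]_n) : dot c (a - b) = dot c a - dot c b.
Proof. by rewrite dotDr dotNr. Qed.

Lemma dotZr n k (a b : 'cV[R]_n) : dot b (k *: a) = k * dot b a.
Proof. by rewrite dotC dotZl dotC. Qed.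

Lemma dot_mulmxl n p (M : 'M[R]_(n, p)) (a : 'cV[R]_p) b :
  dot (M *m a) b = dot a (M^T *m b).
Proof. by rewrite /dot trmx_mul mulmxA. Qed.

Lemma dot_ge0 n (a : 'cV[R]_n) : 0 <= dot a a.
Proof. by rewrite dotE sumr_ge0// => i _; rewrite -expr2 sqr_ge0. Qed.

Lemma sqr_entry_le_dot n (a : 'cV[R]_n) i : (a i 0) ^+ 2 <= dot a a.
Proof.
rewrite dotE (bigD1 i)//= expr2 lerDl sumr_ge0// => j _.
by rewrite -expr2 sqr_ge0.
Qed.

Lemma quadformE n (N : 'M[R]_n) y : quadform N y = dot y (N *m y).
Proof. by rewrite /quadform /dot mulmxA. Qed.

(** Expand the form of N at [k *: a - b], which is nonnegative, and divide by k. *)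
Lemma psd_young n (N : 'M[R]_n) (a b : 'cV[R]_n) (k : R) : psdmx N -> 0 < k ->
  2 * dot a (N *m b) <= k * quadform N a + k^-1 * quadform N b.
Proof.
move=> [Ns N0] k0; have := N0 (k *: a - b).
rewrite !quadformE mulmxBr -scalemxAr !(dotBl, dotBr) !(dotZl, dotZr).
have -> : dot b (N *m a) = dot a (N *m b) by rewrite dotC dot_mulmxl Ns.
move=> H.
have : 0 <= k^-1 * (k * (k * dot a (N *m a)) - k * dot a (N *m b)
   - (k * dot a (N *m b) - dot b (N *m b))).
  by rewrite mulr_ge0 ?invr_ge0 ?(ltW k0).
rewrite (_ : k^-1 * _ = k * dot a (N *m a) - 2 * dot a (N *m b)
  + k^-1 * dot b (N *m b)); first lra.
by field; rewrite gt_eqF.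
Qed.

Lemma psd_scalar1 n : psdmx (1%:M : 'M[R]_n).
Proof. by split=> [|y]; [exact: trmx1|rewrite quadformE mul1mx dot_ge0]. Qed.

Lemma dot_young n (a b : 'cV[R]_n) (k : R) : 0 < k ->
  2 * dot a b <= k * dot a a + k^-1 * dot b b.
Proof.
by move=> k0; have := psd_young a b (psd_scalar1 n) k0; rewrite !quadformE !mul1mx.
Qed.

Lemma quadform_bounded n (N : 'M[R]_n) : exists2 C, 0 < C &
  forall y, quadform N y <= C * dot y y.
Proof.
(* The 1 keeps the constant positive when N = 0. *)
exists (1 + \sum_i \sum_j `|N i j|); first by rewrite ltr_pwDl// !sumr_ge0// => ? _; rewrite sumr_ge0.
move=> y; rewrite quadformE mulrDl mul1r.
apply: le_trans (_ : (\sum_i \sum_j `|N i j|) * dot y y <= _); last first.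
  by rewrite lerDr dot_ge0.
rewrite dotE mulr_suml; apply: ler_sum => i _; rewrite mxE mulr_sumr mulr_suml.
apply: ler_sum => j _; apply: le_trans (ler_norm _) _.
rewrite mulrCA normrM ler_wpM2l//.
have yi := sqr_entry_le_dot y i; have yj := sqr_entry_le_dot y j.
by rewrite ler_norml; apply/andP; split; nra.
Qed.

Lemma mulmx_bounded n p (M : 'M[R]_(n, p)) : exists2 C, 0 < C &
  forall y, dot (M *m y) (M *m y) <= C * dot y y.
Proof.
have [C C0 CP] := quadform_bounded (M^T *m M); exists C => // y.
by rewrite dot_mulmxl mulmxA -quadformE.
Qed.

Lemma pdmx_psd n (N : 'M[R]_n) : pdmx N -> psdmx N.
Proof.
move=> [Ns N0]; split=> // y; have [->|/N0/ltW//] := eqVneq y 0.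
by rewrite quadformE mulmx0 dotE big1// => i _; rewrite mxE mul0r.
Qed.

Lemma pdmx_unit n (N : 'M[R]_n) : pdmx N -> N \in unitmx.
Proof.
move=> [_ N0]; rewrite unitmxE unitfE; apply/det0P => -[v v0 vN].
have /N0 : v^T != 0.
  by apply: contra v0 => /eqP v0; rewrite -(trmxK v) v0 trmx0.
by rewrite /quadform trmxK vN mul0mx mxE ltxx.
Qed.

Lemma pdmx_inv n (N : 'M[R]_n) : pdmx N -> pdmx (invmx N).
Proof.
move=> Npd; have Nu := pdmx_unit Npd; case: Npd => Ns N0.
split=> [|y y0]; first by rewrite trmx_inv Ns.
have := N0 (invmx N *m y); rewrite !quadformE mulKVmx// dotC; apply.
by apply: contra y0 => /eqP Ny; rewrite -(mulKVmx Nu y) Ny mulmx0.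
Qed.

Lemma pdmxD n (N M : 'M[R]_n) : pdmx N -> psdmx M -> pdmx (N + M).
Proof.
move=> [Ns N0] [Ms M0]; split=> [|y y0]; first by rewrite linearD /= Ns Ms.
rewrite quadformE mulmxDl dotDr -!quadformE.
by apply: ltr_pwDl; [exact: N0|exact: M0].
Qed.

Lemma psdmxD n (N M : 'M[R]_n) : psdmx N -> psdmx M -> psdmx (N + M).
Proof.
move=> [Ns N0] [Ms M0]; split=> [|y]; first by rewrite linearD /= Ns Ms.
by rewrite quadformE mulmxDl dotDr -!quadformE addr_ge0.
Qed.

Lemma diag_psdmx n (D : 'M[R]_n) : is_diag_mx D -> (forall i, 0 <= D i i) ->
  psdmx D.
Proof.
move=> Dd D0; split.
  apply/matrixP => i j; rewrite mxE; have [->//|ij] := eqVneq i j.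
  by rewrite !(is_diag_mxP Dd)// eq_sym.
move=> y; rewrite quadformE dotE sumr_ge0// => i _.
rewrite mxE (bigD1 i)//= big1 ?addr0 => [|j ji].
  by rewrite mulrCA mulr_ge0// -expr2 sqr_ge0.
by rewrite (is_diag_mxP Dd) ?mul0r// eq_sym.
Qed.

Lemma diagcE n (v : 'cV[R]_n) i j : diagc v i j = v i 0 *+ (i == j).
Proof. by rewrite /diagc !mxE. Qed.

Lemma diagc_mulmx n (v y : 'cV[R]_n) i : (diagc v *m y) i 0 = v i 0 * y i 0.
Proof.
rewrite mxE (bigD1 i)//= big1 ?addr0 => [|j ji]; first by rewrite diagcE eqxx.
by rewrite diagcE eq_sym (negbTE ji) mul0r.
Qed.

Lemma diagc_psdmx n (v : 'cV[R]_n) : (forall i, 0 <= v i 0) -> psdmx (diagc v).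
Proof.
move=> v0; apply: diag_psdmx => [|i]; first exact: diag_mx_is_diag.
by rewrite diagcE eqxx mulr1n.
Qed.

Lemma invmx_diagc n (v : 'cV[R]_n) : (forall i, v i 0 != 0) ->
  invmx (diagc v) = diagc (\col_i (v i 0)^-1).
Proof.
move=> v0; have vV : diagc v *m diagc (\col_i (v i 0)^-1) = 1%:M.
  apply/matrixP => i j; rewrite !mxE (bigD1 i)//= big1 ?addr0 => [|k ki].
    by rewrite !diagcE eqxx mxE mulr1n mulrnAr divff.
  by rewrite diagcE eq_sym (negbTE ki) mul0r.
have [vu _] := mulmx1_unit vV.
by rewrite -[RHS](mulKmx vu) vV mulmx1.
Qed.

(* Cauchy-Schwarz in the inner product of N: y_i is the N-product of y with
   the i-th column of N^-1. *)
Lemma pdmx_coercive n (N : 'M[R]_n) : pdmx N -> exists2 k, 0 < k &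
  forall y, k * dot y y <= quadform N y.
Proof.
move=> Npd; have Nu := pdmx_unit Npd; have [Ns N0] := Npd.
have [_ Nge0] := pdmx_psd Npd.
pose c i := quadform N (invmx N *m delta_mx i 0).
have c0 i : 0 <= c i by exact: Nge0.
have cs i (y : 'cV[R]_n) : (y i 0) ^+ 2 <= c i * quadform N y.
  have [->|y0] := eqVneq y 0; first by rewrite mxE expr0n mulr_ge0.
  have b0 := N0 _ y0; set b := quadform N y in b0 *.
  pose a : 'cV[R]_n := invmx N *m delta_mx i 0.
  have ay : dot (N *m y) a = y i 0.
    rewrite dot_mulmxl Ns /a mulKVmx// dotE (bigD1 i)//= big1 ?addr0 => [|j ji].
      by rewrite mxE !eqxx mulr1.
    by rewrite mxE (negbTE ji) mulr0.
  have ya : dot y (N *m a) = y i 0 by rewrite -ay dot_mulmxl Ns.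
  (* The form of N at this vector equals b (c_i b - y_i^2), and b > 0 can be cancelled. *)
  have := Nge0 (b *: a - y i 0 *: y).
  rewrite quadformE mulmxBr -!scalemxAr !(dotBl, dotBr) !(dotZl, dotZr) ya.
  have -> : dot a (N *m y) = y i 0 by rewrite dotC ay.
  rewrite -!quadformE -/b -/(c i) => H.
  have : 0 <= b * (c i * b - y i 0 ^+ 2) by move: H; rewrite /c -/a; lra.
  by rewrite pmulr_rge0// subr_ge0.
have s0 : 0 < 1 + \sum_i c i by rewrite ltr_pwDl// sumr_ge0.
exists (1 + \sum_i c i)^-1; first by rewrite invr_gt0.
move=> y; rewrite -(ler_pM2l s0) mulrA divff ?gt_eqF// mul1r mulrDl mul1r.
apply: le_trans (_ : (\sum_i c i) * quadform N y <= _); last by rewrite lerDr.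
by rewrite dotE mulr_suml ler_sum// => i _; rewrite -expr2.
Qed.

End Dot.

(** * Lipschitz maps and the state space *)

Section MatrixNorm.
Variable R : realType.

Lemma mx_norm_le p q (A : 'M[R]_(p, q)) c : 0 <= c ->
  (forall i j, `|A i j| <= c) -> `|A| <= c.
Proof. by move=> c0 Ac; rewrite [`|A|]mx_normrE; apply: bigmax_le => // ij _. Qed.

Lemma mx_entry_le p q (A : 'M[R]_(p, q)) i j : `|A i j| <= `|A|.
Proof.
rewrite [leRHS]mx_normrE.
exact: (le_bigmax _ (fun ij : 'I_p * 'I_q => `|A ij.1 ij.2|) (i, j)).
Qed.

Lemma mulmx_norm_le p q r (A : 'M[R]_(p, q)) (B : 'M[R]_(q, r)) :
  `|A *m B| <= q%:R * (`|A| * `|B|).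
Proof.
apply: mx_norm_le => [|i j]; first by rewrite !mulr_ge0.
rewrite mxE; apply: le_trans (ler_norm_sum _ _ _) _.
apply: le_trans (_ : \sum_(k < q) `|A| * `|B| <= _).
  by apply: ler_sum => k _; rewrite normrM ler_pM// mx_entry_le.
by rewrite sumr_const card_ord mulr_natl.
Qed.

Lemma pair_norm (E E' : normedModType R) (x : E * E') :
  `|x| = Num.max `|x.1| `|x.2|.
Proof. by []. Qed.

End MatrixNorm.

Section BoundedLipschitz.
Variables (R : realType) (E : normedModType R) (B : set E).

(** The bound and the Lipschitz constant travel together because a product of Lipschitz maps is
    Lipschitz only where both factors are bounded. *)
Definition bounded_lipschitz (E' : normedModType R) (g : E -> E') :=
  exists2 C, 0 <= C & forall x y, B x -> B y ->
    `|g x| <= C /\ `|g x - g y| <= C * `|x - y|.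

Lemma bounded_lipschitz_cst (E' : normedModType R) (a : E') :
  bounded_lipschitz (fun=> a).
Proof. by exists `|a| => // x y _ _; rewrite subrr normr0 mulr_ge0. Qed.

Lemma bounded_lipschitzD (E' : normedModType R) (g h : E -> E') :
  bounded_lipschitz g -> bounded_lipschitz h ->
  bounded_lipschitz (fun x => g x + h x).
Proof.
move=> [C C0 gC] [D D0 hD]; exists (C + D); first exact: addr_ge0.
move=> x y Bx By; have [g1 g2] := gC _ _ Bx By; have [h1 h2] := hD _ _ Bx By.
split; first by apply: le_trans (ler_normD _ _) _; exact: lerD.
by rewrite opprD addrACA mulrDl; apply: le_trans (ler_normD _ _) _; exact: lerD.
Qed.

Lemma bounded_lipschitzN (E' : normedModType R) (g : E -> E') :
  bounded_lipschitz g -> bounded_lipschitz (fun x => - g x).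
Proof.
move=> [C C0 gC]; exists C => // x y Bx By; have [g1 g2] := gC _ _ Bx By.
by rewrite -opprD !normrN.
Qed.

Lemma bounded_lipschitzB (E' : normedModType R) (g h : E -> E') :
  bounded_lipschitz g -> bounded_lipschitz h ->
  bounded_lipschitz (fun x => g x - h x).
Proof.
by move=> gB hB; apply: bounded_lipschitzD => //; exact: bounded_lipschitzN.
Qed.

Lemma bounded_lipschitz_mulmx p q r (g : E -> 'M[R]_(p, q))
    (h : E -> 'M[R]_(q, r)) :
  bounded_lipschitz g -> bounded_lipschitz h ->
  bounded_lipschitz (fun x => g x *m h x).
Proof.
move=> [C C0 gC] [D D0 hD]; exists (2 * (q%:R * (C * D))).
  by rewrite !mulr_ge0.
move=> x y Bx By; have [g1 g2] := gC _ _ Bx By; have [h1 h2] := hD _ _ Bx By.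
have [h3 _] := hD _ _ By Bx.
have K0 : 0 <= q%:R * (C * D) by rewrite !mulr_ge0.
split.
  apply: le_trans (mulmx_norm_le _ _) _.
  apply: le_trans (_ : q%:R * (C * D) <= _); last lra.
  by rewrite ler_wpM2l// ler_pM.
have -> : g x *m h x - g y *m h y = g x *m (h x - h y) + (g x - g y) *m h y.
  by rewrite mulmxBr mulmxBl subrKA.
apply: le_trans (ler_normD _ _) _.
have -> : 2 * (q%:R * (C * D)) * `|x - y|
    = q%:R * (C * (D * `|x - y|)) + q%:R * (C * `|x - y| * D) by ring.
by apply: lerD; apply: le_trans (mulmx_norm_le _ _) _; rewrite ler_wpM2l// ler_pM.
Qed.

Lemma bounded_lipschitz_mx p q (g : E -> 'M[R]_(p, q)) :
  (forall i j, bounded_lipschitz (fun x => g x i j)) -> bounded_lipschitz g.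
Proof.
move=> gij; have C_ i j := cid2 (gij i j).
pose C := \sum_i \sum_j s2val (C_ i j).
have C_ge0 i j : 0 <= s2val (C_ i j) by case: (C_ i j).
have CC i j : s2val (C_ i j) <= C.
  rewrite /C (bigD1 i)//= (bigD1 j)//= -addrA lerDl addr_ge0 ?sumr_ge0// => k _.
  by rewrite sumr_ge0.
have C0 : 0 <= C by rewrite sumr_ge0// => i _; rewrite sumr_ge0.
exists C => // x y Bx By; split; apply: mx_norm_le => //.
- move=> i j; have [g1 _] := s2valP' (C_ i j) x y Bx By.
  exact: le_trans (CC i j).
- by rewrite mulr_ge0.
- move=> i j; rewrite !mxE; have [_ g2] := s2valP' (C_ i j) x y Bx By.
  by apply: le_trans g2 _; rewrite ler_wpM2r.
Qed.

Lemma bounded_lipschitzV (g : E -> R) c : 0 < c ->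
  (forall x, B x -> c <= g x) -> bounded_lipschitz g ->
  bounded_lipschitz (fun x => (g x)^-1).
Proof.
move=> c0 cg [C C0 gC]; have ic0 : 0 <= c^-1 by rewrite invr_ge0 ltW.
exists (c^-1 + c^-1 * c^-1 * C); first by rewrite !(addr_ge0, mulr_ge0).
move=> x y Bx By; have [_ gxy] := gC _ _ Bx By.
have gx := cg _ Bx; have gy := cg _ By.
have gx0 : 0 < g x by exact: lt_le_trans gx.
have gy0 : 0 < g y by exact: lt_le_trans gy.
have ix : (g x)^-1 <= c^-1 by rewrite lef_pV2.
have iy : (g y)^-1 <= c^-1 by rewrite lef_pV2.
have ix0 : 0 <= (g x)^-1 by rewrite invr_ge0 ltW.
have iy0 : 0 <= (g y)^-1 by rewrite invr_ge0 ltW.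
split.
  by rewrite ger0_norm//; apply: le_trans ix _; rewrite lerDl !mulr_ge0.
have -> : (g x)^-1 - (g y)^-1 = - ((g x)^-1 * (g y)^-1 * (g x - g y)).
  by field; rewrite !gt_eqF.
rewrite normrN normrM (ger0_norm (mulr_ge0 ix0 iy0)) mulrDl.
apply: le_trans (_ : c^-1 * c^-1 * C * `|x - y| <= _); last first.
  by rewrite lerDr mulr_ge0.
by rewrite -[leRHS]mulrA ler_pM ?mulr_ge0// ler_pM.
Qed.

Lemma bounded_lipschitz_pair (E1 E2 : normedModType R) (g : E -> E1) (h : E -> E2) :
  bounded_lipschitz g -> bounded_lipschitz h ->
  bounded_lipschitz (fun x => (g x, h x) : (E1 * E2)%type).
Proof.
move=> [C C0 gC] [D D0 hD]; exists (C + D); first exact: addr_ge0.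
move=> x y Bx By; have [g1 g2] := gC _ _ Bx By; have [h1 h2] := hD _ _ Bx By.
have xy0 : 0 <= `|x - y| by [].
rewrite !pair_norm/= !ge_max mulrDl; split; apply/andP; split.
- by apply: le_trans g1 _; rewrite lerDl.
- by apply: le_trans h1 _; rewrite lerDr.
- by apply: le_trans g2 _; rewrite lerDl mulr_ge0.
- by apply: le_trans h2 _; rewrite lerDr mulr_ge0.
Qed.

End BoundedLipschitz.

(** Covers the projections of a state on its components and on single coordinates. *)
Lemma bounded_lipschitz_contraction (R : realType) (E E' : normedModType R)
    (x0 : E) (r : R) (g : E -> E') : 0 <= r ->
  (forall x y, g (x - y) = g x - g y) -> (forall x, `|g x| <= `|x|) ->
  bounded_lipschitz [set x | `|x - x0| <= r] g.
Proof.
move=> r0 gB gc; exists (1 + (r + `|x0|)); first by rewrite !addr_ge0.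
move=> x y xr _; split.
  apply: le_trans (gc x) _; rewrite -(subrK x0 x).
  by apply: le_trans (ler_normD _ _) _; apply: le_trans (lerD xr (lexx _)) _; rewrite lerDr.
rewrite -gB; apply: le_trans (gc _) _; rewrite mulrDl mul1r lerDl.
by rewrite mulr_ge0// addr_ge0.
Qed.

(** * From the quadratic Taylor estimate to a derivative *)

Section TaylorCurves.
Variables (R : realType) (E : normedModType R) (f : E -> E).

(** Transfers a derivative to a curve glued from two pieces, and to a formula that agrees with the
    original one only on J. *)
Lemma is_derive_within_local (J J' : set R) (x y : R -> E) t d dx : 0 < d ->
  (forall s, J' s -> `|s - t| < d -> J s /\ y s = x s) -> y t = x t ->
  is_derive_within J x t dx -> is_derive_within J' y t dx.
Proof.
move=> d0 JJ yxt /is_derive_withinP xd; apply/is_derive_withinP => e e0.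
have [d' d'0 dP] := xd e e0; exists (Num.min d d'); first by rewrite lt_min d0.
move=> s J's; rewrite lt_min => /andP[sd sd']; have [Js ->] := JJ s J's sd.
by rewrite yxt; exact: dP.
Qed.

(** The estimate expands at the left endpoint. To the right of t it yields the derivative at once.
    To the left, the expansion is at s, and exchanging [f (z s)] for [f (z t)] costs another L M (t
    - s)^2. *)
Lemma taylor_curve_derive (B : set E) (L M a0 b0 : R) (z : R -> E) t :
  0 <= L -> 0 <= M -> a0 <= t <= b0 ->
  (forall u v, B u -> B v -> `|f u - f v| <= L * `|u - v|) ->
  (forall s, a0 <= s <= b0 -> B (z s)) ->
  (forall a b, a0 <= a -> a <= b -> b <= b0 -> `|z b - z a| <= (b - a) * M) ->
  (forall a b, a0 <= a -> a <= b -> b <= b0 ->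
    `|z b - z a - (b - a) *: f (z a)| <= L * M * (b - a) ^+ 2) ->
  is_derive_within [set s | a0 <= s <= b0] z t (f (z t)).
Proof.
move=> L0 M0 t0 fL Bz zM zT; apply/is_derive_withinP => e e0.
have C0 : 0 <= 2 * (L * M) by rewrite !mulr_ge0.
(* Makes 2 L M |s - t| <= e; the added 1 avoids a zero denominator. *)
exists (e / (2 * (L * M) + 1)); first by rewrite divr_gt0 ?ltr_wpDl.
move=> s s0; rewrite ltr_pdivlMr ?ltr_wpDl// => se.
have LM0 : 0 <= L * M by rewrite mulr_ge0.
apply: le_trans (_ : 2 * (L * M) * `|s - t| ^+ 2 <= _); last first.
  by rewrite expr2 [leLHS]mulrA ler_wpM2r// mulrC; apply: le_trans (ltW se); rewrite mulrDr mulr1 lerDl.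
have /andP[a0t tb0] := t0; have /andP[a0s sb0] := s0.
have [st|ts] := leP t s.
  have := zT _ _ a0t st sb0; rewrite ger0_norm ?subr_ge0//.
  have : 0 <= L * M * (s - t) ^+ 2 by rewrite mulr_ge0// sqr_ge0.
  lra.
have st := ltW ts.
have -> : z s - z t - (s - t) *: f (z t)
    = - (z t - z s - (t - s) *: f (z s)) + (t - s) *: (f (z t) - f (z s)).
  rewrite opprB scalerBr [RHS]addrC subrKA -(opprB t s) scaleNr opprK opprB.
  by rewrite addrC.
apply: le_trans (ler_normD _ _) _; rewrite normrN normrZ.
have ts0 : 0 <= t - s by rewrite subr_ge0.
rewrite (distrC s t) (ger0_norm ts0).
have := zT _ _ a0s st tb0.
have : (t - s) * `|f (z t) - f (z s)| <= (t - s) * (L * ((t - s) * M)).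
  rewrite ler_wpM2l//; apply: le_trans (fL _ _ (Bz _ t0) (Bz _ s0)) _.
  by rewrite ler_wpM2l// zM.
lra.
Qed.

End TaylorCurves.

(** * Coordinates of the state space *)

Section StateSpace.
Variables (R : realType) (n m : nat).
Local Notation E := (state R n m).

Lemma state_norm_le (x : E) c : 0 <= c -> (forall i, `|sIs x i 0| <= c) ->
  (forall k, `|sIt x k 0| <= c) -> (forall i, `|sV x i 0| <= c) -> `|x| <= c.
Proof.
move=> c0 h1 h2 h3; rewrite !pair_norm !ge_max -andbA.
by apply/and3P; split; apply: mx_norm_le => // i j; rewrite ord1.
Qed.

Lemma sIs_norm_le (x : E) : `|sIs x| <= `|x|.
Proof. by rewrite !pair_norm !le_max lexx. Qed.

Lemma sIt_norm_le (x : E) : `|sIt x| <= `|x|.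
Proof. by rewrite !pair_norm !le_max lexx orbT. Qed.

Lemma sV_norm_le (x : E) : `|sV x| <= `|x|.
Proof. by rewrite !pair_norm !le_max lexx !orbT. Qed.

Lemma cvg_sIs (T : Type) (F : set_system T) {FF : Filter F} (f : T -> E) (l : E) :
  f @ F --> l -> sIs (f x) @[x --> F] --> sIs l.
Proof.
move=> /cvgrPdist_le fl; apply/cvgrPdist_le => e /fl.
by apply: filterS => x; exact: le_trans (sIs_norm_le _).
Qed.

Lemma cvg_sIt (T : Type) (F : set_system T) {FF : Filter F} (f : T -> E) (l : E) :
  f @ F --> l -> sIt (f x) @[x --> F] --> sIt l.
Proof.
move=> /cvgrPdist_le fl; apply/cvgrPdist_le => e /fl.
by apply: filterS => x; exact: le_trans (sIt_norm_le _).
Qed.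

Lemma cvg_sV (T : Type) (F : set_system T) {FF : Filter F} (f : T -> E) (l : E) :
  f @ F --> l -> sV (f x) @[x --> F] --> sV l.
Proof.
move=> /cvgrPdist_le fl; apply/cvgrPdist_le => e /fl.
by apply: filterS => x; exact: le_trans (sV_norm_le _).
Qed.

Lemma cvg_state (T : Type) (F : set_system T) {FF : Filter F} (f : T -> E) (l : E) :
  sIs (f x) @[x --> F] --> sIs l -> sIt (f x) @[x --> F] --> sIt l ->
  sV (f x) @[x --> F] --> sV l -> f @ F --> l.
Proof.
move=> /cvgrPdist_le h1 /cvgrPdist_le h2 /cvgrPdist_le h3.
apply/cvgrPdist_le => e e0; near=> x; rewrite !pair_norm !ge_max -andbA.
by apply/and3P; split; near: x; [exact: h1|exact: h2|exact: h3].
Unshelve. all: by end_near. Qed.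

Section Derive.
Variables (J : set R) (x : R -> E) (t : R) (dx : E).
Hypothesis xd : is_derive_within J x t dx.

Lemma is_derive_within_sIs :
  is_derive_within J (fun s => sIs (x s)) t (sIs dx).
Proof. exact: (cvg_sIs xd). Qed.

Lemma is_derive_within_sIt :
  is_derive_within J (fun s => sIt (x s)) t (sIt dx).
Proof. exact: (cvg_sIt xd). Qed.

Lemma is_derive_within_sV :
  is_derive_within J (fun s => sV (x s)) t (sV dx).
Proof. exact: (cvg_sV xd). Qed.

End Derive.

(** The norm is the maximum of the absolute values of the coordinates, so the real inequality
    applied to each coordinate keeps the constant M. *)
Lemma state_le_norm_derive_within (T : \bar R) (g : R -> E) (a b M : R) :
  0 <= a -> a <= b -> horizon T b ->
  (forall t, a <= t <= b ->
    exists2 dg, is_derive_within (horizon T) g t dg & `|dg| <= M) ->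
  `|g b - g a| <= (b - a) * M.
Proof.
move=> a0 ab Hb gd.
have M0 : 0 <= M.
  have [|dg _ dgM] := gd a; first by rewrite lexx ab.
  exact: (le_trans (normr_ge0 dg) dgM).
have sc (p : E -> R) : (forall x y, p (x - y) = p x - p y) ->
    (forall x, `|p x| <= `|x|) ->
    (forall t dg, is_derive_within (horizon T) g t dg ->
      is_derive_within (horizon T) (fun s => p (g s)) t (p dg)) ->
    `|p (g b - g a)| <= (b - a) * M.
  move=> pB pc pd; rewrite pB; apply: (@le_norm_derive_within R T (fun s => p (g s))) => // t /gd.
  by move=> [dg gdg dgM]; exists (p dg); [exact: pd|exact: (le_trans (pc dg) dgM)].
apply: state_norm_le; first by rewrite mulr_ge0// subr_ge0.
- move=> i; apply: (sc (fun x => sIs x i 0)).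
  + by move=> x y; rewrite /sIs !mxE.
  + by move=> x; exact: (le_trans (mx_entry_le _ _ _) (sIs_norm_le x)).
  + by move=> t dg /is_derive_within_sIs /is_derive_within_mxP; exact.
- move=> i; apply: (sc (fun x => sIt x i 0)).
  + by move=> x y; rewrite /sIt !mxE.
  + by move=> x; exact: (le_trans (mx_entry_le _ _ _) (sIt_norm_le x)).
  + by move=> t dg /is_derive_within_sIt /is_derive_within_mxP; exact.
- move=> i; apply: (sc (fun x => sV x i 0)).
  + by move=> x y; rewrite /sV !mxE.
  + by move=> x; exact: (le_trans (mx_entry_le _ _ _) (sV_norm_le x)).
  + by move=> t dg /is_derive_within_sV /is_derive_within_mxP; exact.
Qed.

Lemma real_summable_steps_cvg (u : nat -> R) :
  cvgn (series (fun k => `|u k.+1 - u k|)) -> cvgn u.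
Proof.
move=> us; have sc : cvgn (series (telescope u)) by exact: normed_cvg.
have -> : u = (fun k => u 0%N + series (telescope u) k).
  by apply/funext => k; rewrite -eq_sum_telescope.
by apply: is_cvgD => //; exact: is_cvg_cst.
Qed.

Lemma state_summable_steps_cvg (u : nat -> E) :
  cvgn (series (fun k => `|u k.+1 - u k|)) -> cvgn u.
Proof.
move=> us.
have sc (p : E -> R) : (forall x y, p (x - y) = p x - p y) ->
    (forall x, `|p x| <= `|x|) -> cvgn (p \o u).
  move=> pB pc; apply: real_summable_steps_cvg.
  apply: series_le_cvg us => // k; rewrite /= -pB; exact: pc.
have c1 i : cvgn (fun k => sIs (u k) i 0).
  apply: (sc (fun x => sIs x i 0)); first by move=> x y; rewrite /sIs !mxE.
  by move=> x; exact: (le_trans (mx_entry_le _ _ _) (sIs_norm_le x)).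
have c2 i : cvgn (fun k => sIt (u k) i 0).
  apply: (sc (fun x => sIt x i 0)); first by move=> x y; rewrite /sIt !mxE.
  by move=> x; exact: (le_trans (mx_entry_le _ _ _) (sIt_norm_le x)).
have c3 i : cvgn (fun k => sV (u k) i 0).
  apply: (sc (fun x => sV x i 0)); first by move=> x y; rewrite /sV !mxE.
  by move=> x; exact: (le_trans (mx_entry_le _ _ _) (sV_norm_le x)).
pose l : E := (\col_i limn (fun k => sIs (u k) i 0),
  \col_i limn (fun k => sIt (u k) i 0), \col_i limn (fun k => sV (u k) i 0)).
apply/cvg_ex; exists l; apply: cvg_state; apply/cvg_mxP => i j; rewrite ord1 mxE.
- exact: c1.
- exact: c2.
- exact: c3.
Qed.

End StateSpace.

(** * Extension of solutions *)

Section Extension.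
Variables (R : realType) (n m : nat).
Local Notation E := (state R n m).
Variables (X : set E) (F : E -> E -> Prop) (f : E -> E) (xe : E) (r M L T : R).
Hypothesis r_gt0 : 0 < r.
Hypothesis M_ge0 : 0 <= M.
Hypothesis L_ge0 : 0 <= L.
Hypothesis FP : forall z dz, F z dz <-> dz = f z.
(** Twice the radius of the ball that traps the solution: around each of its points there remains
    room r for a new local solution. *)
Let B : set E := [set z | `|z - xe| <= 2 * r].
Hypothesis BX : B `<=` X.
Hypothesis f_bnd : forall z, B z -> `|f z| <= M.
Hypothesis f_lip : forall z z', B z -> B z' -> `|f z - f z'| <= L * `|z - z'|.
Variable x : R -> E.
Hypothesis x_sol : solution X (fun=> F) T%:E x.
Hypothesis x_ball : forall t, horizon T%:E t -> `|x t - xe| <= r.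

Let xB t : horizon T%:E t -> B (x t).
Proof. by move=> /x_ball xt; rewrite /B/=; have := r_gt0; lra. Qed.

Let xd t : horizon T%:E t -> is_derive_within (horizon T%:E) x t (f (x t)).
Proof. by move=> Ht; have [_ /(_ _ Ht)[_ [dx xdx /FP <-]]] := x_sol. Qed.

Let x_dist a b : 0 <= a -> a <= b -> horizon T%:E b ->
  `|x b - x a| <= (b - a) * M.
Proof.
move=> a0 ab Hb; apply: (state_le_norm_derive_within a0 ab Hb) => t /andP[at_ tb].
have Ht : horizon T%:E t by apply: horizon_le Hb _ tb; exact: le_trans at_.
by exists (f (x t)); [exact: xd|apply: f_bnd; exact: xB].
Qed.

(** Brings a given solution into the class compared by [taylor_curve_unique]: the mean value
    inequality is applied to [x s - s *: f (x a)], whose derivative is at most L (b - a) M. *)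
Let x_taylor a b : 0 <= a -> a <= b -> horizon T%:E b ->
  `|x b - x a - (b - a) *: f (x a)| <= L * M * (b - a) ^+ 2.
Proof.
move=> a0 ab Hb; pose g s := x s - s *: f (x a).
have Ha : horizon T%:E a by exact: horizon_le Hb a0 ab.
have -> : x b - x a - (b - a) *: f (x a) = g b - g a.
  rewrite /g scalerBl !opprB [LHS]addrACA [RHS]addrACA; congr (_ + _).
  exact: addrC.
have -> : L * M * (b - a) ^+ 2 = (b - a) * (L * ((b - a) * M)) by ring.
apply: (state_le_norm_derive_within a0 ab Hb) => t /andP[at_ tb].
have Ht : horizon T%:E t by apply: horizon_le Hb _ tb; exact: le_trans at_.
exists (f (x t) - f (x a)).
  apply: is_derive_withinB; first exact: xd.
  have := @is_derive_within_bilinear R (horizon T%:E) t R^o E E *:%R id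
    (fun=> f (x a)) 1 0.
  rewrite scale1r scaler0 addr0; apply.
  - by move=> *; rewrite scalerBl.
  - by move=> *; rewrite scalerBr.
  - by move=> *; rewrite -scalerA.
  - by move=> *; rewrite !scalerA mulrC.
  - by move=> F' u v a' b' FF' ua vb; exact: cvgZ ua vb.
  - exact: is_derive_within_id.
  - exact: is_derive_within_cst.
apply: le_trans (f_lip (xB Ht) (xB Ha)) _; rewrite ler_wpM2l//.
apply: le_trans (x_dist a0 at_ Ht) _; rewrite ler_wpM2r//; lra.
Qed.

(** The existence time d is the same for every start in the trapping ball. A local solution that
    starts less than d before T therefore outlives T, and uniqueness identifies it with x up to
    T. *)
Lemma solution_extend : exists T' y, [/\ T < T',
  solution X (fun=> F) T'%:E y & forall t, horizon T%:E t -> y t = x t].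
Proof.
have T_gt0 : 0 < T by have [] := x_sol; rewrite lte_fin.
pose d := r / (M + 1).
have d_gt0 : 0 < d by rewrite divr_gt0 ?ltr_wpDl.
have dM : d * M <= r.
  rewrite /d mulrAC ler_pdivrMr ?ltr_wpDl//; have := r_gt0; nra.
(* Half a step before T, or 0 if T is shorter than that. *)
pose s0 := Num.max 0 (T - d / 2).
have s0_ge0 : 0 <= s0 by rewrite le_max lexx.
have s0T : s0 < T by rewrite gt_max T_gt0 /=; lra.
have Ts0d : T < s0 + d.
  by have : T - d / 2 <= s0; [rewrite le_max lexx orbT|lra].
have Hs0 : horizon T%:E s0 by split; rewrite ?lte_fin.
have ballB z : `|z - x s0| <= r -> B z.
  move=> zr; rewrite /B /= -(subrKA (x s0)); apply: le_trans (ler_normD _ _) _.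
  by have := x_ball Hs0; lra.
have [z [z0 zball zdist ztaylor]] : exists z : R -> E, [/\ z 0 = x s0,
    forall t, 0 <= t <= d -> `|z t - x s0| <= r,
    forall a b, 0 <= a -> a <= b -> b <= d -> `|z b - z a| <= (b - a) * M &
    forall a b, 0 <= a -> a <= b -> b <= d ->
      `|z b - z a - (b - a) *: f (z a)| <= L * M * (b - a) ^+ 2].
  apply: (@euler_flow _ _ f (x s0) r M L d) => //.
  - exact: state_summable_steps_cvg.
  - exact: ltW.
  - by move=> u /ballB/f_bnd.
  - by move=> u v /ballB Bu /ballB; exact: f_lip.
pose y t := if t < T then x t else z (t - s0).
(* On the overlap of the two pieces y can be read as either one, so no separate argument is needed
   at the junction T. *)
have yz t : s0 <= t -> t <= s0 + d -> y t = z (t - s0).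
  move=> s0t td; rewrite /y; case: ltP => // tT.
  have xE : x t = x (s0 + (t - s0)) by rewrite addrC subrK.
  have Hs u : 0 <= u -> u <= t - s0 -> horizon T%:E (s0 + u).
    by move=> u0 ut; split; [rewrite addr_ge0|rewrite lte_fin; lra].
  rewrite xE; apply: (@taylor_curve_unique R E f B L (L * M) (t - s0)
    (fun u => x (s0 + u)) z) => //.
  - by rewrite mulr_ge0.
  - by rewrite subr_ge0.
  - by move=> u /andP[u0 ut]; apply: xB; exact: Hs.
  - by move=> u /andP[u0 ut]; apply/ballB/zball; apply/andP; split=> //; lra.
  - move=> a b a0 ab bt.
    have := @x_taylor (s0 + a) (s0 + b) _ _ (Hs _ (le_trans a0 ab) bt).
    rewrite (_ : s0 + b - (s0 + a) = b - a); last by ring.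
    by apply; [rewrite addr_ge0|rewrite lerD2l].
  - by move=> a b a0 ab bt; apply: ztaylor => //; lra.
  - by rewrite addr0 z0.
have zd t : s0 <= t <= s0 + d ->
    is_derive_within [set s | s0 <= s <= s0 + d] (fun s => z (s - s0)) t (f (z (t - s0))).
  move=> t0.
  apply: (@taylor_curve_derive R E f B L M s0 (s0 + d) (fun s => z (s - s0))) => //.
  - by move=> s /andP[h1 h2]; apply/ballB/zball; apply/andP; split; lra.
  - move=> a b a0 ab bd; have := zdist (a - s0) (b - s0).
    rewrite (_ : b - s0 - (a - s0) = b - a); last by ring.
    by apply; lra.
  - move=> a b a0 ab bd; have := ztaylor (a - s0) (b - s0).
    rewrite (_ : b - s0 - (a - s0) = b - a); last by ring.
    by apply; lra.
exists (s0 + d), y; split=> //; last first.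
  by move=> t [_]; rewrite lte_fin /y => ->.
split; first by rewrite lte_fin; lra.
move=> t [t0]; rewrite lte_fin => td; have [tT|Tt] := ltP t T.
  have Ht : horizon T%:E t by split; rewrite ?lte_fin.
  have yt : y t = x t by rewrite /y tT.
  rewrite yt; split; first by apply: BX; exact: xB.
  exists (f (x t)); last by apply/FP.
  apply: (@is_derive_within_local R E (horizon T%:E) _ x _ _ (T - t)) (xd Ht) => //.
    by rewrite subr_gt0.
  move=> s [s0' _]; rewrite ltr_norml => /andP[_ sT].
  have sT' : s < T by lra.
  by split; [split; rewrite ?lte_fin|rewrite /y sT'].
have t0d : s0 <= t <= s0 + d by apply/andP; split; lra.
have yt : y t = z (t - s0) by apply: yz; lra.
rewrite yt; split; first by apply/BX/ballB/zball; apply/andP; split; lra.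
exists (f (z (t - s0))); last by apply/FP.
(* The window of radius t - s0 > 0 also contains times before T, which matters at t = T, where the
   derivative is two-sided. *)
apply: (@is_derive_within_local R E [set s | s0 <= s <= s0 + d] _
  (fun s => z (s - s0)) _ _ (t - s0)) (zd _ t0d) => //.
  by rewrite subr_gt0; exact: lt_le_trans Tt.
move=> s [_]; rewrite lte_fin => sd; rewrite ltr_norml => /andP[st _].
split; first by apply/andP; split; lra.
by apply: yz; lra.
Qed.

End Extension.

(** * The closed loop *)

Section DeriveForms.
Variables (R : realType) (J : set R) (t : R).

Lemma is_derive_within_dot n (a b : R -> 'cV[R]_n) da db :
  is_derive_within J a t da -> is_derive_within J b t db ->
  is_derive_within J (fun s => dot (a s) (b s)) t (dot da (b t) + dot (a t) db).
Proof.
move=> /is_derive_within_trmx ad bd.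
have /is_derive_within_mxP/(_ 0 0) := is_derive_within_mulmx ad bd.
by rewrite mxE.
Qed.

Lemma is_derive_within_quadform n (N : 'M[R]_n) (a : R -> 'cV[R]_n) da :
  N^T = N -> is_derive_within J a t da ->
  is_derive_within J (fun s => quadform N (a s)) t (2 * dot da (N *m a t)).
Proof.
move=> Ns ad; have := is_derive_within_dot ad (is_derive_within_mulmxl (A := N) ad).
have -> : dot (a t) (N *m da) = dot da (N *m a t) by rewrite dotC dot_mulmxl Ns.
under eq_fun do rewrite -quadformE.
by rewrite mulr_natl mulr2n.
Qed.

End DeriveForms.

Lemma wnorm_sqr (R : realType) n (N : 'M[R]_n) y : psdmx N ->
  wnorm N y ^+ 2 = quadform N y.
Proof. by move=> [_ N0]; rewrite sqr_sqrtr. Qed.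

Section Network.
Variables (R : realType) (n m : nat) (N : dc_network R n m).
Variables (pi : 'cV[R]_n) (K1 K2 : 'M[R]_n) (Vstar : 'cV[R]_n).
Hypothesis Pl_le_pi : forall i, Pl N i 0 <= pi i 0.
Hypothesis K1_psd : psdmx K1.
Hypothesis K2_pd : pdmx K2.
Hypothesis Vstar_gt0 : forall i, 0 < Vstar i 0.
Local Notation E := (state R n m).
Local Notation X := (@statespace R n m).
Implicit Types (x dx : E) (mu V v : 'cV[R]_n).

Definition stiffness : 'M[R]_n := invmx (Ls N) + K1.
Definition voltage_error x := sV x - Vstar.
Definition line_residual x := Rt N *m sIt x + (Binc N)^T *m sV x.
Definition node_residual x := sIs x + Binc N *m sIt x - load_current N (sV x).
Definition damping V : 'M[R]_n :=
  K2 + ZlV N + diagc (\col_i ((pi i 0 - Pl N i 0) / V i 0 ^+ 2)).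

(** The closed loop for mu = 0, solved for the velocities. [u_PBC] cancels the term of [Rs];
    dividing by [Ls] turns the difference of V and [Vstar] into the part [invmx (Ls N)] of
    [stiffness]. *)
Definition field x : E :=
  (- (stiffness *m voltage_error x) - K2 *m Vdot N x
     - diagc pi *m (invmx (diagc (sV x)) *m invmx (diagc (sV x))) *m Vdot N x,
   - (invmx (Lt N) *m line_residual x),
   Vdot N x).

Let Lsu : Ls N \in unitmx. Proof. exact: pdmx_unit (Ls_pd N). Qed.
Let Ltu : Lt N \in unitmx. Proof. exact: pdmx_unit (Lt_pd N). Qed.
Let Csu : Cs N \in unitmx. Proof. exact: pdmx_unit (Cs_pd N). Qed.

Lemma closed_loopP mu x dx : closed_loop N pi K1 K2 Vstar mu x dx <->
  [/\ sIs dx = mu + sIs (field x), sIt dx = sIt (field x) & sV dx = sV (field x)].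
Proof.
have inj p q (D : 'M[R]_p) (a b : 'M[R]_(p, q)) : D \in unitmx ->
    D *m a = D *m b <-> a = b.
  by move=> Du; split=> [ab|->//]; rewrite -(mulKmx Du a) ab mulKmx.
set u := Ls N *m mu + u_PBC N pi x + u_Stab N K1 K2 Vstar x.
have uE : Ls N *m (mu + sIs (field x)) = u - (Rs N *m sIs x + sV x).
  rewrite /u /u_PBC /u_Stab /field /sIs /= /stiffness /voltage_error.
  rewrite !(mulmxDr, mulmxBr, mulmxN, mulmxDl, mulNmx, mulKVmx)// !mulmxA.
  by apply/matrixP => i j; rewrite !mxE; ring.
rewrite /closed_loop /network_dynamics -/u.
split=> [[h1 h2 h3]|[h1 h2 h3]].
  split.
  - apply/(inj _ _ _ _ _ Lsu); rewrite uE -[LHS]opprK -mulNmx h1.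
    by rewrite opprB.
  - apply/(inj _ _ _ _ _ Ltu); rewrite -[LHS]opprK -mulNmx h2.
    by rewrite /field /sIt /= mulmxN mulKVmx.
  - by apply/(inj _ _ _ _ _ Csu); rewrite h3 /field /sV /= /Vdot mulKVmx.
split.
- by rewrite mulNmx h1 uE opprB.
- by rewrite mulNmx h2 /field /sIt /= mulmxN mulKVmx// opprK.
- by rewrite h3 /field /sV /= /Vdot mulKVmx.
Qed.

Lemma stiffness_pd : pdmx stiffness.
Proof. exact: pdmxD (pdmx_inv (Ls_pd N)) K1_psd. Qed.

Lemma damping_term_ge0 V i :
  0 <= (\col_j ((pi j 0 - Pl N j 0) / V j 0 ^+ 2)) i 0.
Proof. by rewrite mxE divr_ge0 ?subr_ge0// sqr_ge0. Qed.

Lemma damping_psd V : psdmx (damping V).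
Proof.
apply: psdmxD; last exact: diagc_psdmx (damping_term_ge0 V).
apply: psdmxD; first exact: pdmx_psd.
by apply: diag_psdmx; [exact: ZlV_diag|exact: ZlV_ge0].
Qed.

Lemma quadform_K2_le_damping V v : quadform K2 v <= quadform (damping V) v.
Proof.
rewrite /damping !quadformE !mulmxDl !dotDr -!quadformE -addrA lerDl.
apply: addr_ge0; last by have [_] := diagc_psdmx (damping_term_ge0 V); exact.
have [_] : psdmx (ZlV N) by apply: diag_psdmx; [exact: ZlV_diag|exact: ZlV_ge0].
exact.
Qed.

Lemma S_dE x : S_d N K1 Vstar x =
  2^-1 * quadform stiffness (voltage_error x)
  + 2^-1 * quadform (invmx (Lt N)) (line_residual x)
  + 2^-1 * quadform (invmx (Cs N)) (node_residual x).
Proof.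
have psdLs := pdmx_psd (pdmx_inv (Ls_pd N)).
have psdLt := pdmx_psd (pdmx_inv (Lt_pd N)).
have psdCs := pdmx_psd (pdmx_inv (Cs_pd N)).
rewrite /S_d /P_A /S_a !wnorm_sqr//.
rewrite -/(line_residual x) -/(node_residual x) -/(voltage_error x).
have -> : (((sV x)^T *m invmx (Ls N)) *m Vstar) 0 0 = dot (sV x) (invmx (Ls N) *m Vstar).
  by rewrite /dot mulmxA.
rewrite /stiffness (quadformE (_ + _)) mulmxDl dotDr -!quadformE.
have -> : quadform (invmx (Ls N)) (voltage_error x) = quadform (invmx (Ls N)) (sV x)
    - 2 * dot (sV x) (invmx (Ls N) *m Vstar) + quadform (invmx (Ls N)) Vstar.
  rewrite /voltage_error !quadformE mulmxBr !(dotBl, dotBr).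
  have -> : dot Vstar (invmx (Ls N) *m sV x) = dot (sV x) (invmx (Ls N) *m Vstar).
    by rewrite dotC dot_mulmxl; case: psdLs => ->.
  by ring.
by field.
Qed.

Lemma S_d_ge0 x : 0 <= S_d N K1 Vstar x.
Proof.
have [_ h1] := pdmx_psd stiffness_pd.
have [_ h2] := pdmx_psd (pdmx_inv (Lt_pd N)).
have [_ h3] := pdmx_psd (pdmx_inv (Cs_pd N)).
by rewrite S_dE !(addr_ge0, mulr_ge0)// ?invr_ge0.
Qed.

Lemma statespace_neq0 x : X x -> forall i, sV x i 0 != 0.
Proof. by move=> Xx i; rewrite gt_eqF// Xx. Qed.

Lemma line_residualE mu x dx : closed_loop N pi K1 K2 Vstar mu x dx ->
  line_residual x = - (Lt N *m sIt dx).
Proof.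
move=> /closed_loopP[_ -> _].
by rewrite /field /sIt /= mulmxN mulKVmx// opprK.
Qed.

Lemma node_residualE mu x dx : closed_loop N pi K1 K2 Vstar mu x dx ->
  node_residual x = Cs N *m sV dx.
Proof. by move=> /closed_loopP[_ _ ->]; rewrite /field /sV /= /Vdot mulKVmx. Qed.

Section AlongSolution.
Variables (J : set R) (x : R -> E) (t : R) (mu : 'cV[R]_n) (dx : E).
Hypothesis Xx : forall s, J s -> X (x s).
Hypothesis Jt : J t.
Hypothesis xd : is_derive_within J x t dx.
Hypothesis xF : closed_loop N pi K1 K2 Vstar mu (x t) dx.
Let v := sV dx.
Let it := sIt dx.

Let voltage_d : is_derive_within J (fun s => voltage_error (x s)) t v.
Proof.
rewrite -[v]subr0; apply: is_derive_withinB; last exact: is_derive_within_cst.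
exact: is_derive_within_sV.
Qed.

Let line_d : is_derive_within J (fun s => line_residual (x s)) t
  (Rt N *m it + (Binc N)^T *m v).
Proof.
apply: is_derive_withinD; apply: is_derive_within_mulmxl.
  exact: is_derive_within_sIt.
exact: is_derive_within_sV.
Qed.

Let load_d : is_derive_within J (fun s => load_current N (sV (x s))) t
  (ZlV N *m v - diagc (\col_i (Pl N i 0 / sV (x t) i 0 ^+ 2)) *m v).
Proof.
have Vd := is_derive_within_sV xd.
have Zd := is_derive_within_mulmxl (A := ZlV N) Vd.
rewrite -[ZlV N *m v]addr0.
apply: is_derive_withinD.
  exact: is_derive_withinD Zd (is_derive_within_cst _ _ _).
(* [invmx] is entrywise inversion only where no voltage vanishes, which is known on J alone; hence
   the change of formula is made relative to J. *)
apply: (@is_derive_within_local _ _ J _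
  (fun s => \col_i ((sV (x s) i 0)^-1 * Pl N i 0)) _ _ 1) => //.
- move=> s Js _; split=> //; apply/matrixP => i j; rewrite ord1.
  rewrite invmx_diagc; last exact: statespace_neq0 (Xx Js).
  by rewrite diagc_mulmx !mxE.
- apply/matrixP => i j; rewrite ord1.
  rewrite invmx_diagc; last exact: statespace_neq0 (Xx Jt).
  by rewrite diagc_mulmx !mxE.
apply/is_derive_within_mxP => i j; rewrite ord1.
under eq_fun do rewrite mxE.
have /is_derive_within_mxP/(_ i 0) Vid := Vd.
have V0 := statespace_neq0 (Xx Jt) i.
have := is_derive_withinM (is_derive_withinV V0 Vid)
  (is_derive_within_cst J t (Pl N i 0 : R)).
rewrite mulr0 addr0 mxE diagc_mulmx mxE -/v; congr is_derive_within.
by field.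
Qed.

Lemma node_residual_derive : is_derive_within J (fun s => node_residual (x s)) t
  (mu - stiffness *m voltage_error (x t) + Binc N *m it - damping (sV (x t)) *m v).
Proof.
have Bd := is_derive_within_mulmxl (A := Binc N) (is_derive_within_sIt xd).
have := is_derive_withinB (is_derive_withinD (is_derive_within_sIs xd) Bd) load_d.
congr is_derive_within.
have [-> _ vE] := (closed_loopP _ _ _).1 xF.
rewrite /field {1}/sIs /= -[Vdot N (x t)]/(sV (field (x t))) -vE -/v -/it.
have V0 := statespace_neq0 (Xx Jt).
(* The injected term with [pi] splits into a part that cancels the negative damping of the constant
   power loads and a nonnegative rest, which goes into [damping]. *)
have -> : diagc pi *m (invmx (diagc (sV (x t))) *m invmx (diagc (sV (x t)))) *m v
    = diagc (\col_i (Pl N i 0 / sV (x t) i 0 ^+ 2)) *m v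
      + diagc (\col_i ((pi i 0 - Pl N i 0) / sV (x t) i 0 ^+ 2)) *m v.
  apply/matrixP => i j; rewrite ord1 -!mulmxA invmx_diagc// [RHS]mxE.
  by rewrite !diagc_mulmx !mxE; field.
rewrite /damping !mulmxDl.
by apply/matrixP => i j; rewrite !mxE; ring.
Qed.

(** With Lt^-1 w = - it and Cs^-1 y = v, the products of v with A e and of v with B it occur twice
    with opposite signs. Only supply and dissipation remain. *)
Lemma S_d_derive : is_derive_within J (S_d N K1 Vstar \o x) t
  (dot mu v - quadform (Rt N) it - quadform (damping (sV (x t))) v).
Proof.
have [Ss _] := stiffness_pd.
have [Lts _] := pdmx_inv (Lt_pd N); have [Css _] := pdmx_inv (Cs_pd N).
have half (g : R -> R) dg : is_derive_within J g t (2 * dg) ->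
    is_derive_within J (fun s => 2^-1 * g s) t dg.
  move=> gd; have := is_derive_withinM (is_derive_within_cst J t (2^-1 : R)) gd.
  by rewrite mul0r add0r mulrA mulVf// mul1r.
have := is_derive_withinD (is_derive_withinD
  (half _ _ (is_derive_within_quadform Ss voltage_d))
  (half _ _ (is_derive_within_quadform Lts line_d)))
  (half _ _ (is_derive_within_quadform Css node_residual_derive)).
under eq_fun do rewrite -S_dE.
congr is_derive_within.
rewrite (line_residualE xF) (node_residualE xF) mulmxN !mulKmx// !quadformE.
rewrite !(dotDl, dotNl, dotNr) (dotC (stiffness *m _)) (dotC (damping _ *m _)).
rewrite (dotC (Rt N *m _)) (dot_mulmxl (Binc N)^T) trmxK (dotC (Binc N *m _)).
by ring.
Qed.

Lemma cross_term_derive :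
  is_derive_within J (fun s => dot (voltage_error (x s)) (node_residual (x s))) t
    (dot v (Cs N *m v) + dot (voltage_error (x t))
       (mu - stiffness *m voltage_error (x t) + Binc N *m it
        - damping (sV (x t)) *m v)).
Proof.
have := is_derive_within_dot voltage_d node_residual_derive.
by rewrite (node_residualE xF).
Qed.

End AlongSolution.

Lemma passive_S_d : passive X (closed_loop N pi K1 K2 Vstar) (S_d N K1 Vstar)
  (supply_rate N).
Proof.
split=> [x _|T mu x [T0 xS] t Ht]; first exact: S_d_ge0.
have Xx s : horizon T s -> X (x s) by move=> /xS[].
have [_ [dx xd xF]] := xS _ Ht.
eexists; first exact: S_d_derive Xx Ht xd xF.
have [_ _ vE] := (closed_loopP _ _ _).1 xF.
rewrite /supply_rate -/(dot _ _) -[Vdot N (x t)]/(sV (field (x t))) -vE.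
have [_ h1] := pdmx_psd (Rt_pd N); have [_ h2] := damping_psd (sV (x t)).
by have := h1 (sIt dx); have := h2 (sV dx); lra.
Qed.

End Network.

(** * Stability *)

Section Stability.
Variables (R : realType) (n m : nat) (N : dc_network R n m).
Variables (pi : 'cV[R]_n) (K1 K2 : 'M[R]_n) (Vstar : 'cV[R]_n).
Hypothesis Pl_le_pi : forall i, Pl N i 0 <= pi i 0.
Hypothesis K1_psd : psdmx K1.
Hypothesis K2_pd : pdmx K2.
Hypothesis Vstar_gt0 : forall i, 0 < Vstar i 0.
Local Notation E := (state R n m).
Local Notation X := (@statespace R n m).
Local Notation S := (S_d N K1 Vstar).
Local Notation sys := (closed_loop N pi K1 K2 Vstar 0).
Local Notation err := (voltage_error Vstar).
Local Notation w := (line_residual N).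
Local Notation y := (node_residual N).
Local Notation D := (damping N pi K2).

Definition rest_point : E := (Is_bar N Vstar, It_bar N Vstar, Vstar).
Local Notation xe := rest_point.

Let Rtu : Rt N \in unitmx. Proof. exact: pdmx_unit (Rt_pd N). Qed.

Lemma rest_err : err xe = 0. Proof. exact: subrr. Qed.

Lemma rest_line : w xe = 0.
Proof.
rewrite /line_residual /rest_point /sIt /sV /= /It_bar mulmxN -mulmxA mulKVmx//.
by rewrite addNr.
Qed.

Lemma rest_node : y xe = 0.
Proof.
rewrite /node_residual /rest_point /sIs /sIt /sV /= /Is_bar /load_current.
by apply/matrixP => i j; rewrite !mxE; ring.
Qed.

Lemma rest_equilibrium : equilibrium X sys xe.
Proof.
split; first by move=> i; exact: Vstar_gt0.
have vd : Vdot N xe = 0 by rewrite [Vdot _ _](_ : _ = invmx (Cs N) *m y xe)// rest_node mulmx0.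
apply/closed_loopP; split; rewrite /field /sIs /sIt /sV /=.
- by rewrite vd rest_err !mulmx0 oppr0 !addr0.
- by rewrite rest_line mulmx0 oppr0.
- by rewrite vd.
Qed.

Section Convergence.
Variables (T : Type) (F : set_system T).
Context {FF : Filter F}.

(** The limit has positive entries, so V is eventually free of zeros and the entrywise formula for
    the inverse applies. *)
Lemma cvg_load (V : T -> 'cV[R]_n) :
  V @ F --> Vstar -> load_current N (V s) @[s --> F] --> load_current N Vstar.
Proof.
move=> VF; have /cvg_mxP Vi := VF.
have V0 : \forall s \near F, forall i, V s i 0 != 0.
  by apply: filter_forall => i; apply: (cvgr_neq0 _ (Vi i 0)); rewrite gt_eqF.
apply: cvgD; first apply: cvgD; [|exact: cvg_cst|].
  by apply: cvg_mulmx VF; exact: cvg_cst.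
have -> : invmx (diagc Vstar) *m Pl N = \col_i ((Vstar i 0)^-1 * Pl N i 0).
  apply/matrixP => i j; rewrite ord1 invmx_diagc; last by move=> k; rewrite gt_eqF.
  by rewrite diagc_mulmx !mxE.
apply: (@cvg_trans _ ((\col_i ((V s i 0)^-1 * Pl N i 0)) @[s --> F])).
  apply: near_eq_cvg; apply: filterS V0 => s V0.
  apply/matrixP => i j; rewrite ord1 invmx_diagc//.
  by rewrite diagc_mulmx !mxE.
apply/cvg_mxP => i j; rewrite ord1 mxE; under eq_fun do rewrite mxE.
by apply: cvgM; [apply: cvgV; rewrite ?gt_eqF//; exact: Vi|exact: cvg_cst].
Qed.

Lemma cvg_quadform p (M : 'M[R]_p) (g : T -> 'cV[R]_p) : g @ F --> (0 : 'cV[R]_p) ->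
  quadform M (g s) @[s --> F] --> (0 : R).
Proof.
move=> g0; have Mg : M *m g s @[s --> F] --> M *m 0.
  by apply: cvg_mulmx g0; exact: cvg_cst.
have gMg : (g s)^T *m (M *m g s) @[s --> F] --> (0 : 'cV[R]_p)^T *m (M *m 0).
  by apply: cvg_mulmx Mg; exact: cvg_trmx.
have /cvg_mxP/(_ 0 0) := gMg.
rewrite trmx0 mul0mx mxE; under eq_fun do rewrite -/(dot _ _) -quadformE.
exact.
Qed.

Lemma cvg_quadform_inv p (M : 'M[R]_p) (g : T -> 'cV[R]_p) : pdmx M ->
  quadform M (g s) @[s --> F] --> (0 : R) -> g @ F --> (0 : 'cV[R]_p).
Proof.
move=> /pdmx_coercive[k k0 kM] /cvgrPdist_le g0; apply/cvg_mxP => i j; rewrite ord1 mxE.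
apply/cvgrPdist_le => e e0; have ke : 0 < k * e ^+ 2 by rewrite mulr_gt0 ?exprn_gt0.
have := g0 _ ke; apply: filterS => s.
rewrite !sub0r !normrN => gs; have gk := kM (g s).
have gi := sqr_entry_le_dot (g s) i.
have : k * g s i 0 ^+ 2 <= k * e ^+ 2.
  apply: le_trans gs; apply: le_trans (ler_norm _).
  by apply: le_trans gk; rewrite ler_wpM2l// ltW.
by rewrite ler_pM2l// -real_normK ?num_real// ler_sqr// nnegrE ltW.
Qed.

(** Filters are arbitrary in this section: neighbourhoods of the rest point are used here, sequences
    and t tending to infinity in the converse. *)
Lemma cvg_S_d (g : T -> E) : g @ F --> xe -> S (g s) @[s --> F] --> (0 : R).
Proof.
move=> gF; have Vc : sV (g s) @[s --> F] --> Vstar by exact: cvg_sV gF.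
have Ic : sIs (g s) @[s --> F] --> Is_bar N Vstar by exact: cvg_sIs gF.
have Itc : sIt (g s) @[s --> F] --> It_bar N Vstar by exact: cvg_sIt gF.
have half p (M : 'M[R]_p) (h : T -> 'cV[R]_p) : h @ F --> (0 : 'cV[R]_p) ->
    2^-1 * quadform M (h s) @[s --> F] --> (0 : R).
  by move=> h0; rewrite -(mulr0 2^-1); apply: cvgMr; exact: cvg_quadform.
suff : 2^-1 * quadform (stiffness N K1) (err (g s))
    + 2^-1 * quadform (invmx (Lt N)) (w (g s))
    + 2^-1 * quadform (invmx (Cs N)) (y (g s)) @[s --> F] --> (0 + 0 + 0 : R).
  by rewrite !addr0; under [in X in _ -> X]eq_fun do rewrite S_dE//.
apply: cvgD; first apply: cvgD; apply: half.
- by rewrite -rest_err; apply: cvgB => //; exact: cvg_cst.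
- by rewrite -rest_line; apply: cvgD; apply: cvg_mulmx => //; exact: cvg_cst.
- rewrite -rest_node; apply: cvgB; last exact: cvg_load.
  by apply: cvgD => //; apply: cvg_mulmx => //; exact: cvg_cst.
Qed.

(* (V, w, y) are coordinates on the state space, since It = Rt^-1 (w - B^T V)
   and Is = y - B It + I_l(V); S_d controls all three. *)
Lemma cvg_S_d_inv (g : T -> E) : S (g s) @[s --> F] --> (0 : R) -> g @ F --> xe.
Proof.
move=> gS.
have [_ psd1] := pdmx_psd (stiffness_pd N K1_psd).
have [_ psd2] := pdmx_psd (pdmx_inv (Lt_pd N)).
have [_ psd3] := pdmx_psd (pdmx_inv (Cs_pd N)).
have sq (h : T -> R) : (forall s, 0 <= h s) -> (forall s, 2^-1 * h s <= S (g s)) ->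
    h @ F --> (0 : R).
  move=> h0 hS; apply: (@squeeze_cvgr _ _ _ _ (cst 0) (fun s => 2 * S (g s))).
  - by near=> s; rewrite h0 /=; have := hS s; lra.
  - exact: cvg_cst.
  - by rewrite -(mulr0 2); exact: cvgMr.
have e0 : err (g s) @[s --> F] --> (0 : 'cV[R]_n).
  apply: (cvg_quadform_inv (stiffness_pd N K1_psd)); apply: sq => [s|s].
    exact: psd1.
  rewrite S_dE//; have := psd2 (w (g s)); have := psd3 (y (g s)); lra.
have w0 : w (g s) @[s --> F] --> (0 : 'cV[R]_m).
  apply: (cvg_quadform_inv (pdmx_inv (Lt_pd N))); apply: sq => [s|s].
    exact: psd2.
  rewrite S_dE//; have := psd1 (err (g s)); have := psd3 (y (g s)); lra.
have y0 : y (g s) @[s --> F] --> (0 : 'cV[R]_n).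
  apply: (cvg_quadform_inv (pdmx_inv (Cs_pd N))); apply: sq => [s|s].
    exact: psd3.
  rewrite S_dE//; have := psd1 (err (g s)); have := psd2 (w (g s)); lra.
have Vc : sV (g s) @[s --> F] --> Vstar.
  have : err (g s) + Vstar @[s --> F] --> 0 + Vstar.
    by apply: cvgD e0 _; exact: cvg_cst.
  by rewrite add0r; under eq_fun do rewrite /voltage_error subrK.
have Itc : sIt (g s) @[s --> F] --> It_bar N Vstar.
  have : invmx (Rt N) *m (w (g s) - (Binc N)^T *m sV (g s)) @[s --> F]
      --> invmx (Rt N) *m (0 - (Binc N)^T *m Vstar).
    apply: cvg_mulmx; first exact: cvg_cst.
    by apply: cvgB w0 _; apply: cvg_mulmx Vc; exact: cvg_cst.
  rewrite sub0r mulmxN mulmxA; under eq_fun do rewrite /line_residual addrK mulKmx//.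
  exact.
apply: cvg_state => //.
have : y (g s) - Binc N *m sIt (g s) + load_current N (sV (g s)) @[s --> F]
    --> 0 - Binc N *m It_bar N Vstar + load_current N Vstar.
  apply: cvgD; last exact: cvg_load.
  by apply: cvgB y0 _; apply: cvg_mulmx Itc; exact: cvg_cst.
rewrite sub0r (_ : - _ + _ = Is_bar N Vstar); last by rewrite /Is_bar /load_current !addrA.
under eq_fun do rewrite /node_residual (addrAC _ (- load_current _ _)) addrK subrK.
exact.
Unshelve. all: by end_near. Qed.

End Convergence.

(** Otherwise points outside U with S < 1/(k + 1) would converge to the rest point by [cvg_S_d_inv].
    This replaces minimising S over a sphere. It covers triples outside [statespace] too, where
    [invmx] may be a default value: a small S forces V close to [Vstar]. *)
Lemma S_d_sublevel (U : set E) : nbhs xe U ->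
  exists2 c, 0 < c & forall x, S x < c -> U x.
Proof.
move=> xeU; apply: contrapT => H.
have ex k : exists x, S x < k.+1%:R^-1 /\ ~ U x.
  apply: contrapT => Hk; apply: H; exists k.+1%:R^-1; first by rewrite invr_gt0.
  by move=> x Sx; apply: contrapT => Ux; apply: Hk; exists x.
have [u uP] := choice ex.
have uxe : u @ \oo --> xe.
  apply: cvg_S_d_inv; apply: (@squeeze_cvgr _ _ _ _ (cst 0) (fun k => k.+1%:R^-1)).
  - by near=> k; rewrite S_d_ge0//= ltW//; case: (uP k).
  - exact: cvg_cst.
  - exact: cvg_harmonic.
have [k _ kP] := uxe _ xeU.
by case: (uP k) => _; apply; exact: (kP k (leqnn k)).
Unshelve. all: by end_near. Qed.

Lemma S_d_nonincreasing T (x : R -> E) t : solution X (fun=> sys) T x ->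
  horizon T t -> S (x t) <= S (x 0).
Proof.
move=> [T0 xS] Ht; have [t0 _] := Ht.
apply: (@le_derive_within_le0 R T (S \o x)) => // s /andP[s0 st].
have Hs : horizon T s by exact: horizon_le Ht s0 st.
have [_ [dx xd xF]] := xS _ Hs.
have Xx u : horizon T u -> X (x u) by move=> /xS[].
eexists; first exact: S_d_derive Xx Hs xd xF.
have [_ h1] := pdmx_psd (Rt_pd N); have [_ h2] := damping_psd Pl_le_pi K2_pd (sV (x s)).
have -> : dot 0 (sV dx) = 0 by rewrite dotE big1// => i _; rewrite mxE mul0r.
by have := h1 (sIt dx); have := h2 (sV dx); lra.
Qed.

Lemma rest_near_sublevel c : 0 < c -> \forall x \near xe, S x < c.
Proof.
move=> c0; have Sc : S z @[z --> xe] --> (0 : R) by apply: cvg_S_d; exact: cvg_id.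
move/cvgrPdist_lt/(_ c c0) : Sc.
by apply: filterS => x; rewrite sub0r normrN; exact: le_lt_trans (ler_norm _).
Qed.

Lemma rest_stable : lyapunov_stable X sys xe.
Proof.
move=> U /S_d_sublevel[c c0 cU]; near=> x0 => T x xS xx0 t Ht.
apply: cU; apply: le_lt_trans (S_d_nonincreasing xS Ht) _; rewrite xx0.
by near: x0; exact: rest_near_sublevel.
Unshelve. all: by end_near. Qed.

End Stability.

(** * A strict Lyapunov function *)

Section Attractivity.
Variables (R : realType) (n m : nat) (N : dc_network R n m).
Variables (pi : 'cV[R]_n) (K1 K2 : 'M[R]_n) (Vstar : 'cV[R]_n).
Hypothesis Pl_le_pi : forall i, Pl N i 0 <= pi i 0.
Hypothesis K1_psd : psdmx K1.
Hypothesis K2_pd : pdmx K2.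
Hypothesis Vstar_gt0 : forall i, 0 < Vstar i 0.
Local Notation E := (state R n m).
Local Notation X := (@statespace R n m).
Local Notation S := (S_d N K1 Vstar).
Local Notation sys := (closed_loop N pi K1 K2 Vstar 0).
Local Notation err := (voltage_error Vstar).
Local Notation w := (line_residual N).
Local Notation y := (node_residual N).
Local Notation D := (damping N pi K2).
Local Notation A := (stiffness N K1).
Local Notation xe := (rest_point N Vstar).

(** A region with voltages bounded away from zero, on which the terms 1/V and 1/V^2 of the field and
    of [damping] are uniformly bounded. *)
Definition safe : set E := [set x | forall i, Vstar i 0 / 2 <= sV x i 0].

Lemma safe_statespace : safe `<=` X.
Proof. by move=> x sx i; apply: lt_le_trans (sx i); rewrite divr_gt0. Qed.

Lemma damping_bounded : exists2 C, 0 < C & forall x a, safe x ->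
  quadform (D (sV x)) a <= C * dot a a.
Proof.
have [C C0 CP] := quadform_bounded (K2 + ZlV N).
pose c i := (pi i 0 - Pl N i 0) / (Vstar i 0 / 2) ^+ 2.
have c0 i : 0 <= c i by rewrite divr_ge0 ?subr_ge0// sqr_ge0.
exists (C + \sum_i c i); first by rewrite ltr_wpDr// sumr_ge0.
move=> x a sx; rewrite /damping quadformE mulmxDl dotDr -!quadformE mulrDl.
apply: lerD; first exact: CP.
rewrite quadformE dotE mulr_suml; apply: ler_sum => i _.
rewrite diagc_mulmx mxE mulrCA -expr2; apply: ler_pM.
- by rewrite divr_ge0 ?subr_ge0// sqr_ge0.
- exact: sqr_ge0.
- have V0 : 0 < Vstar i 0 / 2 by rewrite divr_gt0.
  have V1 := lt_le_trans V0 (sx i).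
  rewrite ler_wpM2l ?subr_ge0// lef_pV2 ?posrE ?exprn_gt0//.
  by rewrite ler_sqr ?nnegrE ?(ltW V0) ?(ltW V1)//; exact: sx.
- exact: sqr_entry_le_dot.
Qed.

Let cross x := dot (err x) (y x).

Lemma cross_lower : exists2 e0, 0 < e0 & forall e x, 0 < e -> e <= e0 ->
  2^-1 * S x <= S x + e * cross x.
Proof.
have [a a0 aP] := pdmx_coercive (stiffness_pd N K1_psd).
have [k k0 kP] := pdmx_coercive (pdmx_inv (Cs_pd N)).
have [_ psd2] := pdmx_psd (pdmx_inv (Lt_pd N)).
(* Young gives e |cross| <= (e / 2) (|err|^2 + |y|^2), which S / 2 >= (a |err|^2 + k |y|^2) / 4
   absorbs once 2 e <= a and 2 e <= k. *)
exists (Num.min a k / 2); first by rewrite divr_gt0// lt_min a0.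
move=> e x e_gt0 ee; have ea : 2 * e <= a.
  by have : Num.min a k <= a; [rewrite ge_min lexx|lra].
have ek : 2 * e <= k.
  by have : Num.min a k <= k; [rewrite ge_min lexx orbT|lra].
have := dot_young (- err x) (y x) ltr01; rewrite invr1 !mul1r !(dotNl, dotNr) opprK.
have := aP (err x); have := kP (y x); have := psd2 (w x); rewrite S_dE// /cross.
have := dot_ge0 (err x); have := dot_ge0 (y x).
set Q1 := quadform A _; set Q2 := quadform _ (w x); set Q3 := quadform _ (y x).
set d1 := dot (y x) (y x); set d2 := dot (err x) (err x).
move=> d1_0 d2_0 h2 h3 h1 hc.
have h3' : 2 * e * d1 <= Q3 by apply: le_trans h3; rewrite ler_wpM2r.
have h1' : 2 * e * d2 <= Q1 by apply: le_trans h1; rewrite ler_wpM2r.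
have : e * (2 * - dot (err x) (y x)) <= e * (d2 + d1) by rewrite ler_wpM2l// ltW.
lra.
Qed.

(** Measures S in dI_t/dt, dV/dt and the voltage error, the quantities in which the perturbed
    derivative is negative definite; comparing the two yields a rate. *)
Lemma S_d_upper : exists2 C, 0 < C & forall x dx, sys x dx ->
  S x <= C * (dot (sIt dx) (sIt dx) + dot (sV dx) (sV dx) + dot (err x) (err x)).
Proof.
have [a a0 aP] := quadform_bounded A.
have [l l0 lP] := quadform_bounded (Lt N).
have [c c0 cP] := quadform_bounded (Cs N).
exists (a + l + c); first by rewrite !addr_gt0.
move=> x dx xF; rewrite S_dE// (node_residualE xF) (line_residualE xF).
have -> : quadform (invmx (Lt N)) (- (Lt N *m sIt dx)) = quadform (Lt N) (sIt dx).
  rewrite !quadformE mulmxN mulKmx; last exact: pdmx_unit (Lt_pd N).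
  by rewrite dotNl dotNr opprK dotC.
have -> : quadform (invmx (Cs N)) (Cs N *m sV dx) = quadform (Cs N) (sV dx).
  by rewrite !quadformE mulKmx; [rewrite dotC|exact: pdmx_unit (Cs_pd N)].
have := aP (err x); have := lP (sIt dx); have := cP (sV dx).
have := dot_ge0 (err x); have := dot_ge0 (sIt dx); have := dot_ge0 (sV dx).
set d1 := dot (err x) _; set d2 := dot (sIt dx) _; set d3 := dot (sV dx) _.
by move=> d30 d20 d10 h3 h2 h1; nra.
Qed.

Lemma cross_upper : exists2 C, 0 < C & forall x dx, sys x dx ->
  cross x <= C * (dot (sV dx) (sV dx) + dot (err x) (err x)).
Proof.
have [c c0 cP] := mulmx_bounded (Cs N).
exists (1 + c); first by rewrite addr_gt0.
move=> x dx xF; rewrite /cross (node_residualE xF).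
have := dot_young (err x) (Cs N *m sV dx) ltr01; rewrite invr1 !mul1r.
have := cP (sV dx); have := dot_ge0 (err x); have := dot_ge0 (sV dx).
set d1 := dot (err x) (err x); set d3 := dot (sV dx) (sV dx).
by move=> d30 d10 h3 h1; nra.
Qed.

(* The cross term supplies the decay - |V - V*|^2 that dS_d/dt lacks, at a cost
   controlled by the dissipation in dS_d/dt. *)
Lemma cross_rate : exists a C, [/\ 0 < a, 0 < C & forall x dx, safe x -> sys x dx ->
  dot (sV dx) (Cs N *m sV dx) + dot (err x)
    (0 - A *m err x + Binc N *m sIt dx - D (sV x) *m sV dx)
  <= - a * dot (err x) (err x)
     + C * (dot (sIt dx) (sIt dx) + quadform (D (sV x)) (sV dx))].
Proof.
have [a a0 aP] := pdmx_coercive (stiffness_pd N K1_psd).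
have [d d0 dP] := damping_bounded.
have [b b0 bP] := mulmx_bounded (Binc N).
have [c c0 cP] := quadform_bounded (Cs N).
have [k k0 kP] := pdmx_coercive K2_pd.
(* Weight of both Young inequalities: together they spend h (1 + d) / 2 = a / 2 of the decay a
   |err|^2 and leave the other half. *)
pose h := a / (1 + d); have h0 : 0 < h by rewrite divr_gt0// addr_gt0.
have hE : h * (1 + d) = a by rewrite divfK// gt_eqF// addr_gt0.
have hV0 : 0 < h^-1 by rewrite invr_gt0.
exists (a / 2), (c / k + h^-1 * (b + 1)); split; first by rewrite divr_gt0.
  by apply: addr_gt0; [exact: divr_gt0|apply: mulr_gt0 => //; exact: addr_gt0].
move=> x dx sx xF; set v := sV dx; set it := sIt dx; set er := err x.
have h1 := aP er; have h2 := dP x er sx.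
have h3 := bP it; have h4 := cP v.
have h5 : k * dot v v <= quadform (D (sV x)) v.
  by apply: le_trans (kP v) _; exact: quadform_K2_le_damping.
have h4' : quadform (Cs N) v <= c / k * quadform (D (sV x)) v.
  by apply: le_trans h4 _; rewrite -mulrA ler_wpM2l ?(ltW c0)// [leRHS]mulrC ler_pdivlMr// mulrC.
have h6 := dot_young er (Binc N *m it) h0.
have h7 := psd_young (- er) v (damping_psd Pl_le_pi K2_pd (sV x)) h0.
have qN : quadform (D (sV x)) (- er) = quadform (D (sV x)) er.
  by rewrite !quadformE mulmxN dotNl dotNr opprK.
have e0 := dot_ge0 er; set ee := dot er er in h1 h2 h6 e0 *.
rewrite qN dotNl in h7; rewrite sub0r !(dotDr, dotNr) -quadformE -(quadformE A).
set Q := quadform (D (sV x)) v in h4' h5 h7 *.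
have Q0 : 0 <= Q by have [_] := damping_psd Pl_le_pi K2_pd (sV x); exact.
have I0 := dot_ge0 it.
have h3' : h^-1 * dot (Binc N *m it) (Binc N *m it) <= h^-1 * (b * dot it it).
  by rewrite ler_wpM2l// ltW.
have h2' : h * quadform (D (sV x)) er <= h * (d * ee).
  by rewrite ler_wpM2l// ltW.
have ha : h * ee + h * (d * ee) = a * ee.
  by rewrite -hE; ring.
have p1 : 0 <= h^-1 * (b * dot it it) by rewrite !mulr_ge0// ltW.
have p2 : 0 <= h^-1 * Q by rewrite mulr_ge0// ltW.
have p3 : 0 <= h^-1 * dot it it by rewrite mulr_ge0// ltW.
have p4 : 0 <= h^-1 * (b * Q) by rewrite !mulr_ge0// ltW.
have p5 : 0 <= c / k * dot it it by rewrite !mulr_ge0 ?invr_ge0// ltW.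
lra.
Qed.

Lemma strict_decay : exists e c, [/\ 0 < e, 0 < c,
  forall x, 2^-1 * S x <= S x + e * cross x &
  forall x dx, safe x -> sys x dx ->
    - quadform (Rt N) (sIt dx) - quadform (D (sV x)) (sV dx)
    + e * (dot (sV dx) (Cs N *m sV dx) + dot (err x)
        (0 - A *m err x + Binc N *m sIt dx - D (sV x) *m sV dx))
    <= - c * (S x + e * cross x)].
Proof.
have [e1 e10 lower] := cross_lower.
have [a [C [a0 C0 rate]]] := cross_rate.
have [r r0 rP] := pdmx_coercive (Rt_pd N).
have [k k0 kP] := pdmx_coercive K2_pd.
have [B1 B10 SB] := S_d_upper; have [B2 B20 cB] := cross_upper.
(* [e1] keeps the perturbed function above S / 2; the other two bounds let the cross term consume at
   most half of each dissipation term. *)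
pose e := Num.min e1 (Num.min (r / 2 / C) (2^-1 / C)).
have e0 : 0 < e by rewrite !lt_min e10 !divr_gt0.
have ee1 : e <= e1 by rewrite ge_min lexx.
have eCr : e * C <= r / 2.
  by rewrite -ler_pdivlMr// /e !ge_min lexx orbT.
have eC1 : e * C <= 2^-1.
  by rewrite -ler_pdivlMr// /e !ge_min lexx !orbT.
(* The smallest of the decay rates left for dI_t/dt, dV/dt and the voltage error. *)
pose p := Num.min (r / 2) (Num.min (k / 2) (e * a)).
have p0 : 0 < p by rewrite !lt_min !divr_gt0// mulr_gt0.
have pr : p <= r / 2 by rewrite ge_min lexx.
have pk : p <= k / 2 by rewrite !ge_min lexx orbT.
have pe : p <= e * a by rewrite !ge_min lexx !orbT.
pose B := B1 + e * B2; have B0 : 0 < B by rewrite addr_gt0// mulr_gt0.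
exists e, (p / B); split=> //; first by rewrite divr_gt0.
  by move=> x; exact: lower.
move=> x dx sx xF; have := rate x dx sx xF.
set Z := dot (sV dx) (Cs N *m _) + _; move=> Zr.
have h1 := rP (sIt dx).
have h2 : k * dot (sV dx) (sV dx) <= quadform (D (sV x)) (sV dx).
  by apply: le_trans (kP _) _; exact: quadform_K2_le_damping.
have := SB x dx xF; have := cB x dx xF.
have := dot_ge0 (sIt dx); have := dot_ge0 (sV dx); have := dot_ge0 (err x).
set I := dot (sIt dx) _ in h1 Zr *; set V := dot (sV dx) _ in h2 Zr *.
set er := dot (err x) _ in Zr *; set Q := quadform (D _) _ in h2 Zr *.
move=> er0 V0 I0 cBx SBx.
have Q0 : 0 <= Q by apply: le_trans h2; rewrite mulr_ge0// ltW.
have WB : S x + e * cross x <= B * (I + V + er).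
  have : e * cross x <= e * (B2 * (V + er)) by rewrite ler_wpM2l// ltW.
  have : 0 <= e * (B2 * I) by rewrite !mulr_ge0// ltW.
  by rewrite /B; lra.
have WB' : p / B * (S x + e * cross x) <= p * (I + V + er).
  have pB : 0 <= p / B by rewrite divr_ge0// ltW.
  have := ler_wpM2l pB WB; rewrite mulrA divfK ?gt_eqF//; exact.
have eZ : e * Z <= e * (- a * er + C * (I + Q)) by rewrite ler_wpM2l// ltW.
have f1 : e * C * I <= r / 2 * I by rewrite ler_wpM2r.
have f2 : e * C * Q <= 2^-1 * Q by rewrite ler_wpM2r.
have f3 : p * I <= r / 2 * I by rewrite ler_wpM2r.
have f4 : p * V <= k / 2 * V by rewrite ler_wpM2r.
have f5 : p * er <= e * a * er by rewrite ler_wpM2r.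
lra.
Qed.

End Attractivity.

(** * Attractivity *)

Section LocalAttractivity.
Variables (R : realType) (n m : nat) (N : dc_network R n m).
Variables (pi : 'cV[R]_n) (K1 K2 : 'M[R]_n) (Vstar : 'cV[R]_n).
Hypothesis Pl_le_pi : forall i, Pl N i 0 <= pi i 0.
Hypothesis K1_psd : psdmx K1.
Hypothesis K2_pd : pdmx K2.
Hypothesis Vstar_gt0 : forall i, 0 < Vstar i 0.
Local Notation E := (state R n m).
Local Notation X := (@statespace R n m).
Local Notation S := (S_d N K1 Vstar).
Local Notation sys := (closed_loop N pi K1 K2 Vstar 0).
Local Notation f := (field N pi K1 K2 Vstar).
Local Notation err := (voltage_error Vstar).
Local Notation y := (node_residual N).
Local Notation xe := (rest_point N Vstar).

Lemma closed_loop0P z dz : sys z dz <-> dz = f z.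
Proof.
rewrite closed_loopP; split=> [[]|->]; last by rewrite add0r.
rewrite add0r; case: dz => [[a b] c]; case: (f z) => [[a' b'] c'].
by rewrite /sIs /sIt /sV /= => -> -> ->.
Qed.

Lemma safe_ball : exists2 r, 0 < r & [set x | `|x - xe| <= 2 * r] `<=` safe Vstar.
Proof.
(* Within distance 2 r a voltage changes by at most [Vstar i 0 / 2]. *)
pose r := \big[Num.min/1]_i (Vstar i 0 / 4).
have r0 : 0 < r by apply: lt_bigmin => // i _; rewrite divr_gt0.
exists r => // x xr i.
have rV : r <= Vstar i 0 / 4 by exact: bigmin_le_cond.
have : `|(sV x - Vstar) i 0| <= 2 * r.
  apply: le_trans (mx_entry_le _ _ _) _; apply: le_trans xr.
  exact: (sV_norm_le (x - xe)).
by rewrite !mxE ler_norml => /andP[h _]; lra.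
Qed.

Lemma field_bounded_lipschitz r : 0 < r ->
  [set x | `|x - xe| <= 2 * r] `<=` safe Vstar ->
  bounded_lipschitz [set x | `|x - xe| <= 2 * r] f.
Proof.
move=> r0 Bsafe; set B := [set x | _].
have r20 : 0 <= 2 * r by rewrite mulr_ge0// ltW.
have bV : bounded_lipschitz B (@sV R n m).
  exact: (bounded_lipschitz_contraction _ r20 _ (@sV_norm_le R n m)).
have bIs : bounded_lipschitz B (@sIs R n m).
  exact: (bounded_lipschitz_contraction _ r20 _ (@sIs_norm_le R n m)).
have bIt : bounded_lipschitz B (@sIt R n m).
  exact: (bounded_lipschitz_contraction _ r20 _ (@sIt_norm_le R n m)).
have cst p q (M : 'M[R]_(p, q)) : bounded_lipschitz B (fun=> M).
  exact: bounded_lipschitz_cst.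
have mulc p q s (M : 'M[R]_(p, q)) (g : E -> 'M[R]_(q, s)) :
    bounded_lipschitz B g -> bounded_lipschitz B (fun x => M *m g x).
  by move=> gB; exact: bounded_lipschitz_mulmx.
have bVi i : bounded_lipschitz B (fun x => sV x i 0).
  apply: (bounded_lipschitz_contraction _ r20) => [u v|u]; first by rewrite /sV !mxE.
  exact: le_trans (mx_entry_le _ _ _) (sV_norm_le u).
have bD : bounded_lipschitz B (fun x => invmx (diagc (sV x))).
  apply: bounded_lipschitz_mx => i j.
  have [C C0 CP] : bounded_lipschitz B (fun x => (sV x i 0)^-1 *+ (i == j)).
    case: eqVneq => _ /=; last exact: bounded_lipschitz_cst.
    apply: (@bounded_lipschitzV _ _ _ _ (Vstar i 0 / 2)) => //.
      by rewrite divr_gt0.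
    by move=> x /Bsafe; exact.
  exists C; first exact: C0.
  move=> u v Bu Bv.
  have pos z : B z -> forall k, sV z k 0 != 0.
    by move=> /Bsafe/(safe_statespace Vstar_gt0); exact: statespace_neq0.
  rewrite !invmx_diagc; [|exact: pos|exact: pos].
  by rewrite !diagcE !mxE; exact: CP.
have bload : bounded_lipschitz B (fun x => load_current N (sV x)).
  apply: bounded_lipschitzD; last exact: bounded_lipschitz_mulmx.
  by apply: bounded_lipschitzD => //; exact: mulc.
have bv : bounded_lipschitz B (Vdot N).
  apply: (mulc); apply: bounded_lipschitzB => //.
  by apply: bounded_lipschitzD => //; exact: mulc.
apply: (bounded_lipschitz_pair _ bv); apply: bounded_lipschitz_pair.
  apply: bounded_lipschitzB; last first.
    apply: (bounded_lipschitz_mulmx _ bv); apply: (mulc).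
    exact: bounded_lipschitz_mulmx.
  apply: bounded_lipschitzB; last exact: mulc.
  by apply/bounded_lipschitzN/mulc; exact: bounded_lipschitzB.
apply/bounded_lipschitzN/mulc.
by apply: bounded_lipschitzD; exact: mulc.
Qed.

Lemma S_d_cvg0 (x : R -> E) : solution X (fun=> sys) +oo%E x ->
  (forall t, horizon +oo%E t -> safe Vstar (x t)) -> S (x t) @[t --> +oo] --> (0 : R).
Proof.
move=> [_ xS] xsafe.
have [e [c [e0 c0 lower rate]]] :=
  strict_decay Pl_le_pi K1_psd K2_pd Vstar_gt0.
pose W s := S (x s) + e * dot (err (x s)) (y (x s)).
have Xx s : horizon +oo%E s -> X (x s) by move=> /xS[].
(* Integrating factor: dW/dt <= - c W makes exp (c t) W nonincreasing. *)
have decay t : 0 <= t -> expR (c * t) * W t <= W 0.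
  move=> t0; have Ht : horizon +oo%E t by split=> //; exact: ltry.
  have := @le_derive_within_le0 R +oo%E (fun s => expR (c * s) * W s) 0 t
    (lexx 0) t0 Ht.
  rewrite mulr0 expR0 mul1r; apply=> s /andP[s0 st].
  have Hs : horizon +oo%E s by split=> //; exact: ltry.
  have [_ [dx xd xF]] := xS _ Hs.
  have Sd := S_d_derive K1_psd Xx Hs xd xF.
  have Cd := cross_term_derive Xx Hs xd xF.
  have ed : is_derive_within (horizon +oo%E) (fun u : R => expR (c * u)) s
      (c * expR (c * s)).
    apply: is_derive_is_derive_within.
    have cd : is_derive s 1 (fun u : R => c * u) c.
      by apply: is_derive_eq; rewrite /GRing.scale/= mulr1.
    by apply: is_derive_eq; rewrite mulrC.
  have Wd := is_derive_withinM ed (is_derive_withinD Sd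
    (is_derive_withinM (is_derive_within_cst (horizon +oo%E) s (e : R)) Cd)).
  eexists; first exact: Wd.
  have := rate _ _ (xsafe _ Hs) xF.
  have -> : dot 0 (sV dx) = 0 by rewrite dotE big1// => i _; rewrite mxE mul0r.
  rewrite mul0r !add0r -/(W s) /=.
  set dW := (X in X <= _) => rs.
  have -> : c * expR (c * s) * W s + expR (c * s) * dW
      = expR (c * s) * (c * W s + dW) by ring.
  by apply: mulr_ge0_le0; [exact: expR_ge0|lra].
have W0 : 0 <= W 0.
  by apply: le_trans (lower _); rewrite mulr_ge0 ?invr_ge0// S_d_ge0.
(* For bare convergence the weaker bound from c t <= exp (c t) is enough. *)
apply: (@squeeze_cvgr _ _ _ _ (cst 0) (fun t => 2 * W 0 * (c * t)^-1)).
- near=> t; have t0 : 0 < t by [].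
  have ct : 0 < c * t by rewrite mulr_gt0.
  rewrite S_d_ge0//= ler_pdivlMr//.
  have := decay t (ltW t0); have := lower (x t); rewrite -/(W t) => SW WW.
  have Wt0 : 0 <= W t.
    by apply: le_trans SW; rewrite mulr_ge0 ?invr_ge0// S_d_ge0.
  have : (c * t) * W t <= expR (c * t) * W t.
    by rewrite ler_wpM2r//; apply: le_trans (expR_ge1Dx _); rewrite lerDr.
  have : S (x t) * (c * t) <= 2 * W t * (c * t).
    by rewrite ler_wpM2r ?(ltW ct)//; lra.
  lra.
- exact: cvg_cst.
- suff : 2 * W 0 * (c * t)^-1 @[t --> +oo] --> 2 * W 0 * 0 by rewrite mulr0.
  apply: cvgMr.
  apply/cvgrVy; first by near=> t; rewrite invr_gt0 mulr_gt0.
  apply: (@cvg_trans _ (c * t @[t --> +oo])).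
    by apply: near_eq_cvg; near=> t; exact/esym/invrK.
  by apply: gt0_cvgMry => //; exact: cvg_id.
Unshelve. all: by end_near. Qed.

(** The radius r makes the ball of radius 2 r safe, and c puts a sublevel set of S into the ball of
    radius r. Invariance of that set traps the solution, and the larger ball leaves room to extend
    it. *)
Lemma rest_attractive : locally_attractive X sys xe.
Proof.
have [r r0 Bsafe] := safe_ball.
have [c c0 cB] : exists2 c, 0 < c & forall z, S z < c -> `|z - xe| <= r.
  apply: (S_d_sublevel K1_psd Vstar_gt0).
  apply/nbhs_ballP; exists r => // z; rewrite -ball_normE /= distrC.
  exact: ltW.
near=> x0 => T x [xS xmax] xx0.
have xr t : horizon T t -> `|x t - xe| <= r.
  move=> Ht; apply: cB; apply: le_lt_trans (S_d_nonincreasing Pl_le_pi K1_psd K2_pd xS Ht) _.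
  by rewrite xx0; near: x0; exact: rest_near_sublevel.
have xsafe t : horizon T t -> safe Vstar (x t).
  by move=> /xr xt; apply: Bsafe => /=; lra.
have TE : T = +oo%E.
  (* A finite T is refuted by an extension that contradicts maximality; [-oo] is excluded by 0 <
     T. *)
  case: T xS xmax xr xsafe => [T|//|] xS xmax xr xsafe; last by case: xS.
  have [C C0 fC] := field_bounded_lipschitz r0 Bsafe.
  have [T' [y [TT' yS yx]]] := @solution_extend R n m X sys f xe r C C T
    r0 C0 C0 closed_loop0P (subset_trans Bsafe (safe_statespace Vstar_gt0))
    (fun z Bz => (fC z z Bz Bz).1) (fun z z' Bz Bz' => (fC z z' Bz Bz').2) x xS xr.
  by have := xmax _ _ yS yx; rewrite lee_fin leNgt TT'.
split=> //; subst T.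
apply: (cvg_S_d_inv K1_psd Vstar_gt0); exact: S_d_cvg0.
Unshelve. all: by end_near. Qed.

End LocalAttractivity.

Theorem theorem3 (R : realType) (n m : nat) (N : dc_network R n m)
    (pi : 'cV[R]_n) (K1 K2 : 'M[R]_n) (Vstar : 'cV[R]_n)
    (pi_ge0 : forall i, 0 <= pi i 0)
    (Pl_le_pi : forall i, Pl N i 0 <= pi i 0)
    (K1_psd : psdmx K1) (K2_pd : pdmx K2)
    (Vstar_gt0 : forall i, 0 < Vstar i 0) :
  passive (@statespace R n m) (closed_loop N pi K1 K2 Vstar)
    (S_d N K1 Vstar) (supply_rate N)
  /\
  asymptotically_stable (@statespace R n m) (closed_loop N pi K1 K2 Vstar 0)
    (Is_bar N Vstar, It_bar N Vstar, Vstar).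
Proof.
split; first exact: passive_S_d.
split.
- exact: rest_equilibrium.
- exact: rest_stable.
- exact: rest_attractive.
Qed.
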